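(* Fix $0<\delta<1$ and $B,C>0$, and let $B_c=1+\sqrt{1+1/C}$ and $f(x):=(x+1)\log(x+1)-x\log x$. Then $$\lim_{n\to\infty}\frac{1}{n^{1+\delta}}\log\frac{\mathrm{T}_{n,\delta}(B,C)}{\mathrm{G}_{n,\delta}(B,C)}=\begin{cases}0 & \text{if } B\le B_c,\\[2pt] C(B-B_c)\log\big(1+\frac1C\big)-2\big(f(BC)-f(B_cC)\big) & \text{if } B>B_c,\end{cases}$$ and the value in the case $B>B_c$ is strictly positive.
   Context: For margins $\mathbf a=(a_1,\dots,a_m)\in\mathbb N^m$, $\mathbf b=(b_1,\dots,b_n)\in\mathbb N^n$ with $\sum a_i=\sum b_j=N$, a contingency table is an $m\times n$ matrix with entries in $\mathbb N=\{0,1,2,\dots\}$ with row sums $\mathbf a$ and column sums $\mathbf b$; $\mathrm{T}(\mathbf a,\mathbf b)$ is their number, and $$\mathrm{G}(\mathbf a,\mathbf b):=\binom{N+mn-1}{mn-1}^{-1}\prod_{i=1}^m\binom{a_i+n-1}{n-1}\prod_{j=1}^n\binom{b_j+m-1}{m-1}.$$ For $0\le\delta\le1$, $B,C>0$, $n\ge1$, the Barvinok margins are $\mathbf a=\mathbf b\in\mathbb N^{\lfloor n^\delta\rfloor+n}$ with the first $\lfloor n^\delta\rfloor$ entries equal to $\lfloor BCn\rfloor$ and the remaining $n$ entries equal to $\lfloor Cn\rfloor$; $\mathrm{T}_{n,\delta}(B,C)$ and $\mathrm{G}_{n,\delta}(B,C)$ denote $\mathrm{T}(\mathbf a,\mathbf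 b)$ and $\mathrm{G}(\mathbf a,\mathbf b)$ for these margins. *)

(* Defs.v *)
From HB Require Import structures.
From mathcomp Require Import all_boot all_order all_algebra finmap.
From mathcomp Require Import all_classical all_reals all_analysis.

Set Implicit Arguments.
Unset Strict Implicit.
Unset Printing Implicit Defensive.

Import Order.TTheory GRing.Theory Num.Theory numFieldNormedType.Exports.

Local Open Scope classical_set_scope.
Local Open Scope ring_scope.

Section ContingencyTables.
Variables (m n : nat) (a : 'I_m -> nat) (b : 'I_n -> nat).

Definition contingency_tables : set 'M[nat]_(m, n) :=
  [set M : 'M[nat]_(m, n) | (forall i, (\sum_(j < n) M i j)%N = a i) /\
     (forall j, (\sum_(i < m) M i j)%N = b j)].

(* [fset_set] sends infinite sets to the empty set; this rules that case out. *)
Lemma finite_contingency_tables : finite_set contingency_tables.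
Proof.
pose K := (\sum_(i < m) a i)%N.
apply: (@sub_finite_set _ _
  (range (fun M : 'M['I_K.+1]_(m, n) => \matrix_(i, j) (M i j : nat)))).
- move=> M [rowM _]; exists (\matrix_(i, j) inord (M i j)) => //.
  apply/matrixP => i j; rewrite !mxE inordK// ltnS.
  apply: (@leq_trans (a i)); last by rewrite /K (bigD1 i)//= leq_addr.
  by rewrite -rowM (bigD1 j)//= leq_addr.
- exact/finite_image/finite_finset.
Qed.

(* T(a, b) *)
Definition num_tables : nat := #|` fset_set contingency_tables|%fset.

(* G(a, b), for positive m and n and equal totals of a and b *)
Definition indep_estimate (R : realType) : R :=
  let N := (\sum_(i < m) a i)%N in
  ('C((N + m * n - 1)%N, (m * n - 1)%N)%:R)^-1
  * (\prod_(i < m) 'C((a i + n - 1)%N, (n - 1)%N)%:R)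
  * (\prod_(j < n) 'C((b j + m - 1)%N, (m - 1)%N)%:R).

End ContingencyTables.

Section BarvinokMargins.
Variables (R : realType) (delta B C : R) (n : nat).

(* [Num.truncn] is the floor, as a [nat], of a nonnegative number. *)
Definition barvinok_k : nat := Num.truncn ((n%:R : R) `^ delta).

Definition barvinok_margin (i : 'I_(barvinok_k + n)) : nat :=
  if (i < barvinok_k)%N then Num.truncn (B * C * n%:R)
  else Num.truncn (C * n%:R).

Definition barvinok_T : nat := num_tables barvinok_margin barvinok_margin.

Definition barvinok_G : R := indep_estimate barvinok_margin barvinok_margin R.

End BarvinokMargins.

Definition critical_B (R : realType) (C : R) : R := 1 + Num.sqrt (1 + 1 / C).

Definition entropy_f (R : realType) (x : R) : R :=
  (x + 1) * ln (x + 1) - x * ln x.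

Definition excess (R : realType) (B C : R) : R :=
  C * (B - critical_B C) * ln (1 + 1 / C)
  - 2 * (entropy_f (B * C) - entropy_f (critical_B C * C)).

(* Main.v *)
Require Import Defs.
From HB Require Import structures.
From mathcomp Require Import all_boot all_order all_algebra finmap.
From mathcomp Require Import all_classical all_reals all_analysis.
From mathcomp Require Import zify ring lra.

(* Upper bound: [T <= prod_(i,j) 1 / (1 - x_i x_j) * prod_i x_i ^ (- 2 a_i)] for all
   weights [x_i] with [x_i x_j < 1].

   Lower bound: [T(a, b)] grows when a unit is moved from a larger to a smaller
   entry of [b]. Among all column sums, balanced ones are therefore the most
   frequent, so up to the number [(N + 1) ^ n] of possible column sums there are as
   many tables with balanced columns as matrices with the given row sums, which is
   a product of binomials. Gluing a balanced [k x n] block of mean [x] twice to an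
   [n x n] block, with the excess of the large margins put on the diagonal of the
   [k x k] corner, loses only a factor [exp (O (n log n))].

   Both bounds read [n^2 f(C) + k n (2 f(x) - x f'(C)) + o(k n)], the optimal [x]
   being the smaller of [B C] and [B_c C]; the independence estimate [G] has the
   same expansion with [x = B C], whether or not this is optimal. *)

Set Implicit Arguments.
Unset Strict Implicit.
Unset Printing Implicit Defensive.

Import Order.TTheory GRing.Theory Num.Theory numFieldNormedType.Exports.

Local Open Scope classical_set_scope.
Local Open Scope ring_scope.

(** * Counting tables as finite functions *)

Section TableCounts.
Variables (m n : nat).
Implicit Types (a : 'I_m -> nat) (b : 'I_n -> nat) (M : 'M[nat]_(m, n)).

Local Notation table_family K := {ffun 'I_m -> {ffun 'I_n -> 'I_K.+1}}.

(** Capping the entries at [K] puts the tables in a finite type, where cardinals and the expansion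
    of a product of sums are available. *)
Definition bounded_tables K a b : {set table_family K} :=
  [set F : table_family K | [forall i, (\sum_j F i j)%N == a i] &&
           [forall j, (\sum_i F i j)%N == b j]]%SET.

Arguments bounded_tables : clear implicits.

Lemma leq_num_tables a b (T : finType) (S : {set T}) (f : T -> 'M[nat]_(m, n)) :
    {in S &, injective f} -> {in S, forall x, contingency_tables a b (f x)} ->
  (#|S| <= num_tables a b)%N.
Proof.
move=> finj fS; rewrite cardE -(size_map f); apply: uniq_leq_size.
  rewrite map_inj_in_uniq ?enum_uniq// => x y.
  by rewrite !mem_enum; exact: finj.
move=> M /mapP[x]; rewrite mem_enum => xS ->.
by rewrite in_fset_set; [rewrite inE; exact: fS|exact: finite_contingency_tables].
Qed.

(** An entry is at most its row sum, so the cap removes no table. *)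
Lemma num_tablesE K a b : (\sum_i a i <= K)%N ->
  num_tables a b = #|bounded_tables K a b|.
Proof.
move=> leK; pose f (F : table_family K) : 'M[nat]_(m, n) :=
  \matrix_(i, j) (F i j : nat).
have finj : injective f.
  move=> F G /matrixP FG; apply/ffunP => i; apply/ffunP => j.
  by have := FG i j; rewrite !mxE => /val_inj.
have fS F : F \in bounded_tables K a b -> contingency_tables a b (f F).
  rewrite inE => /andP[/forallP Fa /forallP Fb].
  split=> [i|j]; [rewrite -(eqP (Fa i))|rewrite -(eqP (Fb j))];
  by apply: eq_bigr => ? _; rewrite mxE.
apply/eqP; rewrite eqn_leq (leq_num_tables (in2W finj) fS) andbT.
rewrite [leqRHS]cardE -(size_map f); apply: uniq_leq_size => // M.
rewrite in_fset_set; last exact: finite_contingency_tables.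
rewrite inE => -[Ma Mb].
have leM i j : (M i j <= K)%N.
  apply: leq_trans leK; rewrite (bigD1 i)//= -Ma (bigD1 j)//=.
  by rewrite -addnA leq_addr.
apply/mapP; exists ([ffun i => [ffun j => inord (M i j)]] : table_family K).
  rewrite mem_enum inE; apply/andP; split; apply/forallP => i; apply/eqP;
  [rewrite -Ma|rewrite -Mb]; apply: eq_bigr => j _; 
  by rewrite !ffunE inordK// ltnS.
by apply/matrixP => i j; rewrite !mxE !ffunE inordK// ltnS.
Qed.

Lemma num_tables_gt0_sum a b :
  (0 < num_tables a b)%N -> (\sum_i a i = \sum_j b j)%N.
Proof.
rewrite cardfs_gt0 => /fset0Pn[M].
rewrite in_fset_set; last exact: finite_contingency_tables.
rewrite inE => -[Ma Mb].
rewrite -(eq_bigr _ (fun i _ => Ma i)) -(eq_bigr _ (fun i _ => Mb i)).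
exact: exchange_big.
Qed.

(** * Moving one unit between two columns *)

Section UnitTransfer.
Variables (j1 j2 : 'I_n).

Definition transfer b : 'I_n -> nat :=
  fun j => if j == j1 then (b j).-1 else if j == j2 then (b j).+1 else b j.

(** A lattice path reads the rows in order, going up by the entry in column [j1], then down by the
    entry in column [j2]. The height in row [l] is taken between these two moves. *)
Let height M (l : 'I_m) : int :=
  (\sum_(i < m | (i <= l)%N) M i j1)%:Z - (\sum_(i < m | (i < l)%N) M i j2)%:Z.

Let shift M (l : 'I_m) : 'M[nat]_(m, n) :=
  \matrix_(i, j) if i == l then transfer (M i) j else M i j.

Hypothesis j12 : j1 != j2.

Lemma sum_transfer b : (0 < b j1)%N ->
  (\sum_j transfer b j = \sum_j b j)%N.
Proof.
move=> b0; rewrite (bigD1 j1)// (bigD1 j2) 1?eq_sym//=.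
rewrite [in RHS](bigD1 j1)// [in RHS](bigD1 j2) 1?eq_sym//=.
rewrite (eq_bigr b); last first.
  by move=> j /andP[/negbTE h1 /negbTE h2]; rewrite /transfer h1 h2.
by rewrite /transfer !eqxx eq_sym (negbTE j12); lia.
Qed.

Lemma sum_sqr_transfer b : ((b j2).+1 < b j1)%N ->
  (\sum_j transfer b j ^ 2 < \sum_j b j ^ 2)%N.
Proof.
move=> b12; rewrite (bigD1 j1)// (bigD1 j2) 1?eq_sym//=.
rewrite [in X in (_ < X)%N](bigD1 j1)// [in X in (_ < X)%N](bigD1 j2) 1?eq_sym//=.
rewrite (eq_bigr (fun j => b j ^ 2)%N); last first.
  by move=> j /andP[/negbTE h1 /negbTE h2]; rewrite /transfer h1 h2.
rewrite /transfer !eqxx eq_sym (negbTE j12) !addnA ltn_add2r; nia.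
Qed.

(** The path loses an up step and gains a down step in row [l], the latter after the height of that
    row is read. Heights drop by 0 before [l], by 1 at [l] and by 2 after it, which turns a first
    peak into the last one. *)
Lemma height_shift M l i : (0 < M l j1)%N ->
  height (shift M l) i = height M i - (l <= i)%N%:Z - (l < i)%N%:Z.
Proof.
move=> Ml0; rewrite /height.
have E1 : (\sum_(i0 < m | (i0 <= i)%N) M i0 j1
    = \sum_(i0 < m | (i0 <= i)%N) shift M l i0 j1 + (l <= i))%N.
  rewrite [RHS]addnC; case: leqP => li.
    rewrite (bigD1 l)//= [in RHS](bigD1 l)//= addnA; congr (_ + _)%N.
      by rewrite !mxE /transfer !eqxx add1n prednK.
    by apply: eq_bigr => k /andP[_ /negbTE kl]; rewrite !mxE kl.
  rewrite add0n; apply: eq_bigr => k ki; rewrite !mxE ifN//.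
  by apply: contraTneq ki => ->; rewrite -ltnNge.
have E2 : (\sum_(i0 < m | (i0 < i)%N) shift M l i0 j2
    = \sum_(i0 < m | (i0 < i)%N) M i0 j2 + (l < i))%N.
  rewrite [RHS]addnC; case: ltnP => li.
    rewrite (bigD1 l)//= [in RHS](bigD1 l)//= addnA; congr (_ + _)%N.
      by rewrite !mxE /transfer !eqxx eq_sym (negbTE j12).
    by apply: eq_bigr => k /andP[_ /negbTE kl]; rewrite !mxE kl.
  rewrite add0n; apply: eq_bigr => k ki; rewrite !mxE ifN//.
  by apply: contraTneq ki => ->; rewrite -leqNgt.
by rewrite E1 E2; lia.
Qed.

Definition first_peak M (l : 'I_m) :=
  (forall i, height M i <= height M l) /\
  (forall i : 'I_m, (i < l)%N -> height M i < height M l).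

Lemma first_peak_exists M (i0 : 'I_m) : exists l, first_peak M l.
Proof.
case: (arg_maxP (height M) (erefl : xpredT i0)) => p _ pmax.
case: (arg_minnP (fun l : 'I_m => l : nat)
  (lexx (height M p) : (fun l => height M p <= height M l) p)) => l /= pl lmin.
exists l; split=> [i|i il]; first exact: le_trans (pmax i isT) pl.
rewrite ltNge; apply/negP => li.
by have := lmin i (le_trans pl li); rewrite leqNgt il.
Qed.

Lemma height_succ M (i l : 'I_m) : l = i.+1 :> nat ->
  height M l = height M i + (M l j1)%:Z - (M i j2)%:Z.
Proof.
move=> li; rewrite /height (bigD1 l)//= [X in _ - X%:Z](bigD1 i) ?li//=.
rewrite (eq_bigl (fun k : 'I_m => (k <= i)%N)); last first.
  by move=> k; rewrite -val_eqE /=; lia.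
rewrite [X in _ - (_ + X)%N%:Z](eq_bigl (fun k : 'I_m => (k < i)%N)); last first.
  by move=> k; rewrite -val_eqE /=; lia.
lia.
Qed.

(** Entering the first peak is a strict ascent, which needs an up step. In row 0 the height is the
    entry itself and is at least the height of the last row, positive since column [j1] has the
    larger total. *)
Lemma first_peak_gt0 M l : first_peak M l ->
  (\sum_i M i j2 < \sum_i M i j1)%N -> (0 < M l j1)%N.
Proof.
move=> [lmax lfirst] Mlt.
have m0 : (0 < m)%N by exact: leq_ltn_trans (ltn_ord l).
case: (posnP l) => [l0|l0].
  have lastP : (m.-1 < m)%N by rewrite prednK.
  have lt1 : (\sum_(i < m | (i < m.-1)%N) M i j2 <= \sum_i M i j2)%N.
    by rewrite [leqRHS](bigID (fun i : 'I_m => (i < m.-1)%N))//= leq_addr.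
  have all1 : (\sum_(i < m | (i <= m.-1)%N) M i j1 = \sum_i M i j1)%N.
    by apply: eq_bigl => i; rewrite -ltnS prednK// ltn_ord.
  have only1 : (\sum_(i < m | (i <= l)%N) M i j1 = M l j1)%N.
    rewrite (big_pred1 l)// => i; apply/idP/eqP => [il|-> //].
    by apply/val_inj/eqP; rewrite /= eqn_leq il l0.
  have := lmax (Ordinal lastP); rewrite /height /= all1 only1.
  rewrite [X in _ <= _ - X%:Z]big_pred0 => [|i]; last by rewrite l0.
  rewrite subr0 lerBlDr -PoszD lez_nat => h; rewrite lt0n; apply/eqP => Ml0.
  by move: (leq_trans Mlt h); rewrite Ml0 add0n ltnNge lt1.
have predP : (l.-1 < m)%N by rewrite (leq_ltn_trans (leq_pred _)).
have /= := @height_succ M (Ordinal predP) l; rewrite prednK// => /(_ erefl).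
by have /= := lfirst (Ordinal predP); rewrite prednK// leqnn => /(_ isT); lia.
Qed.

(* The Kashiwara lowering operator: moving one unit at the first peak of the
   height makes that row the last peak, so the move can be undone. *)
Lemma num_tables_transfer a b : (b j2 < b j1)%N ->
  (num_tables a b <= num_tables a (transfer b))%N.
Proof.
move=> blt.
have peak M : contingency_tables a b M -> {l | first_peak M l}.
  move=> [_ Mb]; apply: cid.
  case: (pickP (fun _ : 'I_m => true)) => [i0 _|m0]; first exact: first_peak_exists.
  by move: blt; rewrite -!Mb !big_pred0.
pose f M := if pselect (contingency_tables a b M) is left MX
            then shift M (sval (peak M MX)) else M.
have fE M : contingency_tables a b M ->
    exists l, [/\ first_peak M l, (0 < M l j1)%N & f M = shift M l].
  rewrite /f; case: pselect => // MX _; exists (sval (peak M MX)).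
  by split=> //; [|apply: first_peak_gt0; last by rewrite !MX.2]; exact: svalP.
have finj : {in fset_set (contingency_tables a b) &, injective f}.
  move=> M M'; rewrite !in_fset_set; [|exact: finite_contingency_tables..].
  rewrite !inE => MX MX'.
  have [l [[lmax lfirst] l0 ->]] := fE _ MX.
  have [l' [[lmax' lfirst'] l0' ->]] := fE _ MX' => MM.
  (* Each of [l] and [l'] is the last peak of the common image; [height_shift] reduces this to
     linear arithmetic. *)
  have ll' : l = l'.
    apply/eqP; rewrite -val_eqE eqn_leq; apply/andP; split; rewrite leqNgt;
    apply/negP => lt.
      have := height_shift l l0; have := height_shift l' l0; rewrite MM.
      rewrite !height_shift// ?leqnn ?ltnn ?lt ?(ltnW lt) ?(ltn_geF lt).
      have -> : (l < l')%N = false by apply/negbTE; rewrite -leqNgt ltnW.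
      by have := lfirst _ lt; have := lmax' l; lia.
    have := height_shift l l0'; have := height_shift l' l0'; rewrite -MM.
    rewrite !height_shift// ?leqnn ?ltnn ?lt ?(ltnW lt) ?(ltn_geF lt).
    have -> : (l' < l)%N = false by apply/negbTE; rewrite -leqNgt ltnW.
    by have := lfirst' _ lt; have := lmax l'; lia.
  subst l'; apply/matrixP => i j; move/matrixP/(_ i j): MM; rewrite !mxE.
  case: eqP => // ->; rewrite /transfer.
  by case: eqP => [->|_]; [lia|case: eqP => [_ []|]].
rewrite /num_tables -(size_map f); apply: uniq_leq_size.
  by rewrite map_inj_in_uniq//; exact: fset_uniq.
move=> _ /mapP[M MX ->].
rewrite in_fset_set; last exact: finite_contingency_tables.
move: MX; rewrite in_fset_set; last exact: finite_contingency_tables.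
rewrite !inE => MX; have [l [_ l0 ->]] := fE _ MX; have [Ma Mb] := MX.
split=> [i|j].
  rewrite -Ma; case: (eqVneq i l) => [->|il].
    by rewrite -(sum_transfer (b := M l))//; apply: eq_bigr => j _; rewrite mxE eqxx.
  by apply: eq_bigr => j _; rewrite mxE (negbTE il).
rewrite (bigD1 l)//= mxE eqxx.
rewrite (eq_bigr (fun i => M i j)) => [|i /negbTE il]; last by rewrite mxE il.
rewrite /transfer -!Mb [in RHS](bigD1 l)//=.
case: eqP => [->|_]; last by case: eqP.
by move: l0; case: (M l j1) => // p _; rewrite addSn.
Qed.

End UnitTransfer.

End TableCounts.
Arguments bounded_tables {m n} K a b.


(** * Balanced column sums and the counting bounds *)

Definition balanced n (b : 'I_n -> nat) := forall i j, (b i <= (b j).+1)%N.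

(** Sum [b i <= b j + 1] over all [j]; the term [j = i] is strict. *)
Lemma balanced_lt n (b : 'I_n -> nat) i :
  balanced b -> (n * b i < n + \sum_j b j)%N.
Proof.
move=> bal; rewrite -[n in (n * _)%N]card_ord -sum_nat_const.
rewrite -[n in (n + _)%N]card_ord -sum1_card -big_split/=.
rewrite (bigD1 i)//= [ltnRHS](bigD1 i)//= -addSn add1n leq_add2l.
by apply: leq_sum => j _; exact: bal.
Qed.

(** By [balanced_lt] no entry exceeds [c], and one entry below [c] would make the total too
    small. *)
Lemma balanced_const n (b : 'I_n -> nat) c :
  balanced b -> (\sum_j b j = n * c)%N -> b = (fun=> c).
Proof.
move=> bal sumb.
have le1 i : (b i <= c)%N.
  have := balanced_lt i bal; rewrite sumb -mulnS ltn_mul2l ltnS.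
  by case/andP.
apply/funext => i; apply/eqP; rewrite eqn_leq le1 /= leqNgt; apply/negP => lt.
suff: (\sum_j b j < n * c)%N by rewrite sumb ltnn.
rewrite -[n in (n * _)%N]card_ord -sum_nat_const (bigD1 i)//= [ltnRHS](bigD1 i)//=.
by rewrite -addSn leq_add// leq_sum.
Qed.

(** Among the maximisers take one with least sum of squares. If two entries differed by more than
    one, a unit transfer would keep the count maximal and lower that sum. *)
Lemma num_tables_max_balanced m n (a : 'I_m -> nat) (b0 : 'I_n -> nat) :
    (0 < num_tables a b0)%N ->
  exists b : 'I_n -> nat, [/\ balanced b, (\sum_j b j = \sum_i a i)%N &
    forall b' : 'I_n -> nat, (num_tables a b' <= num_tables a b)%N].
Proof.
move=> T0; set N := (\sum_i a i)%N.
pose val_fun (b : {ffun 'I_n -> 'I_N.+1}) := fun j => b j : nat.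
have val_funP b : (0 < num_tables a b)%N -> exists b', val_fun b' = b.
  move=> /num_tables_gt0_sum sumab; exists [ffun j => inord (b j)].
  apply/funext => j; rewrite /val_fun ffunE inordK// ltnS /N sumab.
  by rewrite (bigD1 j)//= leq_addr.
have [f0 f0E] := val_funP _ T0.
case: (arg_maxnP (fun f => num_tables a (val_fun f)) (erefl : xpredT f0)).
move=> f1 _ max1.
case: (@arg_minnP _ f1
  (fun f => num_tables a (val_fun f1) <= num_tables a (val_fun f))%N
  (fun f => \sum_j val_fun f j ^ 2)%N (leqnn _)) => f2 max2 min2.
have maxT (b' : 'I_n -> nat) : (num_tables a b' <= num_tables a (val_fun f2))%N.
  apply: leq_trans max2; have [->//|T'] := posnP (num_tables a b').
  by have [f <-] := val_funP _ T'; exact: max1.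
have T2 : (0 < num_tables a (val_fun f2))%N by exact: leq_trans T0 (maxT _).
exists (val_fun f2); split=> // [i j|]; last exact/esym/num_tables_gt0_sum.
rewrite leqNgt; apply/negP => lt.
have ij : i != j by apply: contraTneq lt => ->; rewrite -leqNgt.
have Tle := num_tables_transfer ij a (ltnW lt).
have [f3 f3E] := val_funP _ (leq_trans T2 Tle).
have := min2 f3; rewrite f3E => /(_ (leq_trans max2 Tle)).
by rewrite leqNgt sum_sqr_transfer.
Qed.

Lemma card_bounded_compositions n N a : (a <= N)%N ->
  ('C(a + n, n) <= #|[set u : {ffun 'I_n.+1 -> 'I_N.+1} | \sum_j u j == a]%SET|)%N.
Proof.
move=> aN; rewrite addnC -card_ord_partitions.
pose f (t : n.+1.-tuple 'I_a.+1) : {ffun 'I_n.+1 -> 'I_N.+1} :=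
  [ffun j => widen_ord (aN : (a.+1 <= N.+1)%N) (tnth t j)].
have finj : injective f.
  move=> t u /ffunP tu; apply: eq_from_tnth => j.
  by have := tu j; rewrite !ffunE => /(congr1 val) /= /val_inj.
rewrite -(card_imset _ finj); apply/subset_leq_card/fintype.subsetP => _ /imsetP[t ta ->].
move: ta; rewrite !inE big_tuple => /eqP ta; apply/eqP; rewrite -[RHS]ta.
by apply: eq_bigr => j _; rewrite ffunE.
Qed.

(** Filling the rows independently gives the product of binomials. These matrices split by column
    sums into at most [(N + 1) ^ (n + 1)] classes, none larger than the count at a balanced
    maximiser. *)
Lemma exists_balanced_columns m n (a : 'I_m -> nat) :
  let N := (\sum_i a i)%N in
  exists b : 'I_n.+1 -> nat, [/\ balanced b, (\sum_j b j = N)%N &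
    (\prod_i 'C(a i + n, n) <= num_tables a b * N.+1 ^ n.+1)%N].
Proof.
move=> N.
pose rows i := [set u : {ffun 'I_n.+1 -> 'I_N.+1} | (\sum_j u j)%N == a i]%SET.
pose S := [set F : {ffun 'I_m -> {ffun 'I_n.+1 -> 'I_N.+1}} |
  F \in family (fun i => mem (rows i))]%SET.
have aN i : (a i <= N)%N by rewrite /N (bigD1 i)//= leq_addr.
have prodS : (\prod_i 'C(a i + n, n) <= #|S|)%N.
  rewrite cardsE card_family foldrE big_map enumT.
  by apply: leq_prod => i _; exact: card_bounded_compositions.
have S0 : (0 < #|S|)%N.
  apply: leq_trans prodS; apply: prodn_gt0 => i.
  by rewrite bin_gt0 leq_addl.
(* [inord] does not truncate on [S], where column sums are at most [N]. *)
pose cols (F : {ffun 'I_m -> {ffun 'I_n.+1 -> 'I_N.+1}}) :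
  {ffun 'I_n.+1 -> 'I_N.+1} := [ffun j => inord (\sum_i F i j)%N].
have colsT F : F \in S -> F \in bounded_tables N a (fun j => cols F j).
  rewrite !inE => /familyP FS; apply/andP; split; apply/forallP => i.
    by have := FS i; rewrite !inE.
  rewrite ffunE inordK// ltnS; apply: leq_sum => l _.
  have := FS l; rewrite !inE => /eqP <-.
  by rewrite (bigD1 i)//= leq_addr.
have [F0 F0S] : exists F0, F0 \in S by apply/card_gt0P.
have T0 : (0 < num_tables a (fun j => cols F0 j))%N.
  by rewrite (num_tablesE _ (leqnn N)); apply/card_gt0P; exists F0; exact: colsT.
have [b [bal sumb maxb]] := num_tables_max_balanced T0.
exists b; split => //; apply: leq_trans prodS _.
rewrite -sum1_card (partition_big cols xpredT)//=.
apply: (@leq_trans (\sum_(c : {ffun 'I_n.+1 -> 'I_N.+1}) num_tables a b)).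
  apply: leq_sum => c _; apply: leq_trans (maxb (fun j => c j)).
  rewrite (num_tablesE _ (leqnn N)) sum1_card; apply/subset_leq_card/fintype.subsetP => F.
  by rewrite inE => /andP[/colsT + /eqP <-]; rewrite inE.
rewrite (eq_bigl (mem predT))// sum_nat_const.
by rewrite card_ffun !card_ord mulnC.
Qed.

(* Each table is assembled from the diagonal corner [(A - r) I], a [k x n] table
   [F] (transposed) below it, and a [(k + n) x n] table [G] on the right. *)
Lemma num_tables_two_blocks k n (A c r : nat) (q : 'I_n -> nat) :
    (r <= A)%N -> (forall j, (q j <= c)%N) ->
  let a := fun i : 'I_(k + n) => if (i < k)%N then A else c in
  let a' := fun i : 'I_(k + n) =>
    match fintype.split i with inl _ => r | inr j => (c - q j)%N end in
  is_true (num_tables (fun _ : 'I_k => r) q * num_tables a' (fun _ : 'I_n => c)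
    <= num_tables a a)%N.
Proof.
move=> rA qc a a'.
rewrite (num_tablesE (K := (\sum_(i < k) r)%N) _ (leqnn _)).
rewrite (num_tablesE (K := (\sum_i a' i)%N) _ (leqnn _)) -cardsX.
set S1 := bounded_tables _ _ _; set S2 := bounded_tables _ _ _.
pose f (p : {ffun 'I_k -> {ffun 'I_n -> 'I_(\sum_(i < k) r).+1}} *
    {ffun 'I_(k + n) -> {ffun 'I_n -> 'I_(\sum_i a' i).+1}}) : 'M[nat]_(k + n, k + n) := row_mx
  (col_mx (\matrix_(i < k, j < k) if i == j then (A - r)%N else 0%N)
     (\matrix_(j < n, i < k) (p.1 i j : nat)))
  (\matrix_(i < k + n, j < n) (p.2 i j : nat)).
(* The predicate [g] covers both [i == j] and [j == i], for rows and for columns of the diagonal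
   block. *)
have sum_diag (i : 'I_k) (g : 'I_k -> bool) :
    (forall j, g j = (i == j)) -> (\sum_(j < k) (if g j then A - r else 0) = A - r)%N.
  move=> gE; rewrite (bigD1 i)//= gE eqxx big1 ?addn0// => j ji.
  by rewrite gE eq_sym (negbTE ji).
apply: (@leq_num_tables _ _ _ _ _ _ f).
  move=> [F G] [F' G'] _ _ /eq_row_mx[/eq_col_mx[_ FF] GG].
  congr (_, _); apply/ffunP => i; apply/ffunP => j; apply/val_inj.
    by move/matrixP/(_ j i): FF; rewrite !mxE.
  by move/matrixP/(_ i j): GG; rewrite !mxE.
move=> [F G]; rewrite inE => /andP[]; rewrite !inE /=.
move=> /andP[/forallP/= Fa /forallP/= Fb] /andP[/forallP/= Ga /forallP/= Gb].
split=> i; rewrite big_split_ord/=.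
  under eq_bigr do rewrite row_mxEl.
  under [X in (_ + X)%N]eq_bigr do rewrite row_mxEr mxE.
  rewrite (eqP (Ga i)) /a /a'; case: (fintype.splitP i) => j ij.
    have -> : i = lshift n j by exact: val_inj.
    under eq_bigr => l _ do rewrite col_mxEu mxE.
    by rewrite (sum_diag j)// subnK.
  have -> : i = rshift k j by exact: val_inj.
  under eq_bigr => l _ do rewrite col_mxEd mxE.
  by rewrite (eqP (Fb j)) subnKC.
rewrite -[i]splitK; case: (fintype.split i) => j /=; rewrite /a/= ?ltn_ord.
  under eq_bigr do rewrite row_mxEl col_mxEu mxE.
  under [X in (_ + X)%N]eq_bigr do rewrite row_mxEl col_mxEd mxE.
  by rewrite (sum_diag j) ?(eqP (Fa j)) ?subnK// => l; rewrite eq_sym.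
under eq_bigr do rewrite row_mxEr mxE.
under [X in (_ + X)%N]eq_bigr do rewrite row_mxEr mxE.
by rewrite ltnNge leq_addr/=; have := Gb j; rewrite big_split_ord => /eqP.
Qed.

(** Geometric series expand the right side into a sum over all matrices; every table with margins
    [a] and [b] contributes the same monomial, and the other terms are nonnegative. *)
Lemma num_tables_weight_le (R : realType) m n (a : 'I_m -> nat) (b : 'I_n -> nat)
    (x : 'I_m -> R) (y : 'I_n -> R) :
    (forall i j, 0 < x i * y j < 1) ->
  (num_tables a b)%:R * (\prod_i x i ^+ a i) * (\prod_j y j ^+ b j)
    <= \prod_i \prod_j (1 - x i * y j)^-1.
Proof.
move=> xy; set N := (\sum_i a i)%N.
rewrite (num_tablesE b (leqnn N)) -mulrA mulr_natl -sumr_const.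
pose w (F : {ffun 'I_m -> {ffun 'I_n -> 'I_N.+1}}) :=
  \prod_i \prod_j (x i * y j) ^+ F i j.
rewrite (eq_bigr w) => [|F]; last first.
  rewrite inE => /andP[/forallP Fa /forallP Fb].
  rewrite /w; under [RHS]eq_bigr do under eq_bigr do rewrite exprMn.
  under [RHS]eq_bigr do rewrite big_split/=.
  rewrite big_split/=; congr (_ * _).
    by apply: eq_bigr => i _; rewrite -(eqP (Fa i)) expr_sum.
  rewrite exchange_big/=; apply: eq_bigr => j _.
  by rewrite -(eqP (Fb j)) expr_sum.
have xy0 i j : 0 <= x i * y j by case/andP: (xy i j) => /ltW.
apply: (@le_trans _ _ (\sum_F w F)).
  rewrite [leRHS](bigID (mem (bounded_tables N a b)))/= lerDl sumr_ge0// => F _.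
  by do 2 apply: prodr_ge0 => ? _; exact: exprn_ge0.
(* Distributivity turns the sum over all matrices with entries at most [N] into a product of
   truncated geometric series. *)
rewrite /w -(bigA_distr_bigA (fun i (u : {ffun 'I_n -> 'I_N.+1}) =>
  \prod_j (x i * y j) ^+ u j)).
apply: ler_prod => i _; apply/andP; split.
  by apply: sumr_ge0 => u _; apply: prodr_ge0 => j _; exact: exprn_ge0.
rewrite -(bigA_distr_bigA (fun j (e : 'I_N.+1) => (x i * y j) ^+ e)).
apply: ler_prod => j _; apply/andP; split.
  by apply: sumr_ge0 => u _; exact: exprn_ge0.
have /andP[_ lt1] := xy i j.
rewrite -[leRHS]mul1r ler_pdivlMr ?subr_gt0// mulrC.
have := subrX1 (x i * y j) N.+1; set S := \sum_(_ < _) _ => /eqP.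
rewrite -eqr_opp -mulNr !opprB => /eqP <-.
by rewrite lerBlDr lerDl exprn_ge0.
Qed.

(** [exists_balanced_columns] serves twice: for the [k x n] block, with column sums [q], and for the
    [(k + n) x n] block beside it. The latter has total [n * c], so its balanced column sums are all
    [c], as gluing requires. *)
Lemma num_tables_lower k n (A c r : nat) : (0 < n)%N -> (r <= A)%N ->
  let a := fun i : 'I_(k + n) => if (i < k)%N then A else c in
  exists q : 'I_n -> nat, [/\ forall j, (n * q j < n + k * r)%N,
    (\sum_j q j = k * r)%N &
    (forall j, q j <= c)%N ->
    ('C(r + n - 1, n - 1) ^ (2 * k) * \prod_j 'C(c - q j + n - 1, n - 1)
      <= num_tables a a * ((k * r).+1 * (n * c).+1) ^ n)%N].
Proof.
case: n => // n _ rA a.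
have [q [balq sumq prodq]] := exists_balanced_columns n (fun _ : 'I_k => r).
have sumr : (\sum_(i < k) r = k * r)%N by rewrite sum_nat_const card_ord.
rewrite sumr in sumq prodq.
exists q; split=> // [j|qc]; first by rewrite -sumq; exact: balanced_lt.
have two := num_tables_two_blocks k rA qc; move: two => /=.
set a' := (X in (_ * num_tables X _)%N) => two.
have [b [balb sumb prodb]] := exists_balanced_columns n a'.
have suma' : (\sum_i a' i = n.+1 * c)%N.
  rewrite big_split_ord/= /a'.
  under eq_bigr do rewrite (unsplitK (inl _)).
  under [X in (_ + X)%N]eq_bigr do rewrite (unsplitK (inr _)).
  rewrite sumnB// sumr sumq sum_nat_const card_ord subnKC// -sumq.
  by rewrite -[n.+1 in leqRHS]card_ord -sum_nat_const leq_sum.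
rewrite suma' in sumb prodb.
have bE := balanced_const balb sumb; rewrite {}bE {b balb sumb} in prodb.
move: prodb; rewrite big_split_ord/=.
under eq_bigr do rewrite /a' (unsplitK (inl _)).
under [X in (_ * X <= _)%N]eq_bigr do rewrite /a' (unsplitK (inr _)).
move: prodq; rewrite !prod_nat_const !card_ord => prodq prodb.
rewrite addnS !subn1 /=.
under eq_bigr do rewrite addnS subn1 /=.
rewrite mul2n -addnn expnD -mulnA.
apply: leq_trans (leq_mul prodq prodb) _.
rewrite mulnACA -expnMn leq_mul2r; apply/orP; right; exact: two.
Qed.

(** * Binomial coefficients and entropy *)

(** In the expansion of [(p + q) ^ (p + q)] the term of index [q] is the largest of the [p + q + 1]
    terms. *)
Lemma expn_le_central_binomial (p q : nat) :
  ((p + q) ^ (p + q) <= (p + q).+1 * ('C(p + q, q) * (p ^ p * q ^ q)))%N.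
Proof.
case: (posnP p) => [->|p0]; first by rewrite add0n binn !mul1n leq_pmull.
set N := (p + q)%N; pose t i := ('C(N, i) * (p ^ (N - i) * q ^ i))%N.
(* The ratio of consecutive terms, [(N - i) q / ((i + 1) p)], is at least 1 for [i < q] and at most
   1 from [i = q] on. *)
have step i : (i < N)%N -> (t i.+1 * (i.+1 * p) = t i * ((N - i) * q))%N.
  move=> iN; rewrite /t; have := mul_bin_left N i.
  have -> : (N - i = (N - i.+1).+1)%N by rewrite subnSK.
  rewrite !expnS; set P := (p ^ _)%N; set Q := (q ^ i)%N => E.
  transitivity ((i.+1 * 'C(N, i.+1)) * (P * q * Q * p))%N; first by ring.
  by rewrite E; ring.
have pos i : (0 < i.+1 * p)%N by rewrite muln_gt0.
have up i : (i < q)%N -> (t i <= t i.+1)%N.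
  move=> iq; rewrite -(leq_pmul2r (pos i)) step; last by rewrite /N; lia.
  by apply: leq_mul => //; rewrite mulnC leq_mul// /N; lia.
have down i : (q <= i < N)%N -> (t i.+1 <= t i)%N.
  move=> /andP[qi iN]; rewrite -(leq_pmul2r (pos i)) step//.
  by apply: leq_mul => //; rewrite mulnC leq_mul//; move: iN; rewrite /N; lia.
have t_max i : (i <= N)%N -> (t i <= t q)%N.
  case: (leqP i q) => [iq _|qi iN].
    have [d ->] : exists d, i = (q - d)%N by exists (q - i)%N; rewrite subKn.
    elim: d => [|d IH]; first by rewrite subn0.
    case: (ltnP d q) => dq; last first.
      by move: IH; rewrite (_ : (q - d.+1 = q - d)%N)//; lia.
    apply: leq_trans IH; have -> : (q - d = (q - d.+1).+1)%N by lia.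
    by apply: up; lia.
  have [d dE] : exists d, i = (q + d)%N by exists (i - q)%N; rewrite subnKC// ltnW.
  rewrite {}dE {qi} in iN *.
  elim: d iN => [|d IH] dN; first by rewrite addn0.
  by rewrite addnS; apply: leq_trans (down _ _) (IH _); lia.
have -> : (p ^ p * q ^ q = p ^ (N - q) * q ^ q)%N by rewrite /N addnK.
rewrite -/(t q) Pascal -[N.+1 in leqRHS]card_ord -sum_nat_const.
by apply: leq_sum => i _; apply: t_max; rewrite -ltnS.
Qed.

Section BinomialEstimates.
Variable R : realType.
Implicit Types (rho p q : R).

(* The tangent plane of [(p + q) ln (p + q) - p ln p - q ln q] along [p = rho q]. *)
Definition tangent rho p q : R := p * (ln (1 + rho) - ln rho) + q * ln (1 + rho).

Lemma ln_le_subr1 (x : R) : 0 < x -> ln x <= x - 1.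
Proof.
move=> x0; rewrite -[x in ln x](subrKC 1); apply: le_ln1Dx; lra.
Qed.

(** The tangent plane exceeds the entropy by the relative entropy [p * ln u + q * ln v], and
    [ln z <= z - 1] bounds this by a chi-square distance, the quadratic term. *)
Lemma tangent_le_entropy rho p q : 0 < rho -> 0 < p -> 0 < q ->
  tangent rho p q - (p - rho * q) ^+ 2 / (rho * (p + q))
    <= (p + q) * ln (p + q) - p * ln p - q * ln q.
Proof.
move=> rho0 p0 q0; have pq0 : 0 < p + q by rewrite addr_gt0.
have rho1 : 0 < 1 + rho by rewrite addr_gt0.
(* [u] and [v] compare the shares of [p] and [q] in [p + q] with [rho / (1 + rho)] and
   [1 / (1 + rho)]. *)
pose u := p * (1 + rho) / (rho * (p + q)); pose v := q * (1 + rho) / (p + q).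
have u0 : 0 < u by rewrite divr_gt0 ?mulr_gt0.
have v0 : 0 < v by rewrite divr_gt0 ?mulr_gt0.
have lnu : ln u = ln p + ln (1 + rho) - ln rho - ln (p + q).
  by rewrite ln_div ?posrE ?mulr_gt0// !lnM ?posrE//; ring.
have lnv : ln v = ln q + ln (1 + rho) - ln (p + q).
  by rewrite ln_div ?posrE ?mulr_gt0// !lnM ?posrE//; ring.
have := ler_wpM2l (ltW p0) (ln_le_subr1 u0).
have := ler_wpM2l (ltW q0) (ln_le_subr1 v0); rewrite lnu lnv /tangent.
have -> : (p - rho * q) ^+ 2 / (rho * (p + q)) = p * (u - 1) + q * (v - 1).
  by rewrite /u /v; field; rewrite !gt_eqF.
lra.
Qed.

(** A single term of [(1 + rho) ^ (p + q)] is at most the whole. *)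
Lemma ln_binomial_le rho (p q : nat) : 0 < rho ->
  ln ('C(p + q, q)%:R : R) <= tangent rho p%:R q%:R.
Proof.
move=> rho0; have rho1 : 0 < 1 + rho by rewrite addr_gt0.
have C0 : 0 < ('C(p + q, q)%:R : R) by rewrite ltr0n bin_gt0 leq_addl.
have : 'C(p + q, q)%:R * rho ^+ p <= (1 + rho) ^+ (p + q).
  rewrite addrC exprDn.
  have qlt : (q < (p + q).+1)%N by rewrite ltnS leq_addl.
  rewrite (bigD1 (Ordinal qlt))//= addnK expr1n mulr1 mulr_natl lerDl.
  by apply: sumr_ge0 => i _; rewrite expr1n mulr1 mulrn_wge0// exprn_ge0// ltW.
rewrite -ler_ln ?posrE ?mulr_gt0 ?exprn_gt0// lnM ?posrE ?exprn_gt0//.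
rewrite !lnXn// -(mulr_natl (ln rho)) -(mulr_natl (ln (1 + rho))).
rewrite natrD /tangent; lra.
Qed.

Lemma ln_binomial_ge rho (p q : nat) : 0 < rho -> (0 < q)%N ->
  tangent rho p%:R q%:R
    - (p%:R - rho * q%:R) ^+ 2 / (rho * (p%:R + q%:R)) - ln (p + q).+1%:R
  <= ln ('C(p + q, q)%:R : R).
Proof.
move=> rho0 q0; have q0R : 0 < q%:R :> R by rewrite ltr0n.
have rho1 : 0 < 1 + rho by rewrite addr_gt0.
have C0 : 0 < ('C(p + q, q)%:R : R) by rewrite ltr0n bin_gt0 leq_addl.
(* [tangent_le_entropy] needs [p > 0]. At [p = 0] the quadratic term is [rho q], which is at least
   [q ln (1 + rho)]. *)
have [->|p0] := posnP p.
  rewrite add0n binn ln1 /tangent mul0r add0r sub0r sqrrN add0r exprMn.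
  have -> : rho ^+ 2 * q%:R ^+ 2 / (rho * q%:R) = q%:R * rho.
    by field; rewrite !gt_eqF.
  have := ler_wpM2l (ltW q0R) (ln_le_subr1 rho1).
  have : 0 <= ln (q.+1%:R : R) by rewrite ln_ge0// ler1n.
  lra.
have p0R : 0 < p%:R :> R by rewrite ltr0n.
have := tangent_le_entropy rho0 p0R q0R.
have := expn_le_central_binomial p q; rewrite -(ler_nat R) !natrM !natrX natrD.
rewrite -ler_ln ?posrE ?mulr_gt0 ?exprn_gt0 ?addr_gt0 ?ltr0n ?bin_gt0 ?leq_addl//.
rewrite !lnM ?posrE ?mulr_gt0 ?exprn_gt0 ?ltr0n ?bin_gt0 ?leq_addl//.
rewrite !lnXn ?addr_gt0// -(mulr_natl (ln (_ + _))) -(mulr_natl (ln p%:R)).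
rewrite -(mulr_natl (ln q%:R)) natrD; lra.
Qed.

Lemma compositions_gt0 (p q : nat) : 0 < 'C((p + q - 1)%N, (q - 1)%N)%:R :> R.
Proof. by rewrite ltr0n bin_gt0 leq_sub2r// leq_addl. Qed.

(** The binomial here is [q / (p + q)] times the one in [ln_binomial_ge]; this factor costs the
    second logarithm. *)
Lemma ln_compositions rho (p q : nat) : 0 < rho -> (0 < q)%N ->
  `|ln ('C((p + q - 1)%N, (q - 1)%N)%:R : R) - tangent rho p%:R q%:R|
    <= (p%:R - rho * q%:R) ^+ 2 / (rho * (p%:R + q%:R)) + 2 * ln (p + q).+1%:R.
Proof.
case: q => // q rho0 _; rewrite addnS !subn1 /=.
have q0R : 0 < (q.+1%:R : R) by rewrite ltr0n.
have sq0 : 0 <= (p%:R - rho * q.+1%:R) ^+ 2 / (rho * (p%:R + q.+1%:R)).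
  by rewrite divr_ge0 ?sqr_ge0// mulr_ge0 ?ltW// ltr_wpDl.
have C0 : 0 < ('C(p + q, q)%:R : R) by rewrite ltr0n bin_gt0 leq_addl.
have C1 : 0 < ('C(p + q.+1, q.+1)%:R : R) by rewrite ltr0n bin_gt0 leq_addl.
have l0 : 0 <= ln ((p + q.+1)%N.+1%:R : R) by rewrite ln_ge0// ler1n.
have := mul_bin_diag (p + q.+1) q; rewrite addnS /= => diag.
have le1 : ln ('C(p + q, q)%:R : R) <= ln ('C(p + q.+1, q.+1)%:R : R).
  by rewrite ler_ln ?posrE// ler_nat addnS binS leq_addl.
have le2 : ln ('C(p + q.+1, q.+1)%:R : R)
    <= ln ('C(p + q, q)%:R : R) + ln ((p + q.+1)%N.+1%:R : R).
  rewrite -lnM ?posrE ?ltr0n ?bin_gt0 ?leq_addl// -natrM.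
  rewrite ler_ln ?posrE ?ltr0n ?muln_gt0 ?bin_gt0 ?leq_addl// ler_nat addnS.
  nia.
have := ln_binomial_ge p rho0 (ltn0Sn q); have := ln_binomial_le p q.+1 rho0.
by move: sq0 l0 le1 le2; rewrite addnS => *; rewrite ler_norml; apply/andP; split; lra.
Qed.

End BinomialEstimates.

(** * Error sizes and the independence estimate *)

(** These bounds feed [ln_compositions_le] for the binomials of [G], with one constant for the total
    and both margins; [a] and [c] stand for the floors of [b N] and [C N]. *)
Lemma mixture_bounds (R : realFieldType) (b C k N a c : R) :
    0 < b -> 0 < C -> 1 <= k -> k <= N ->
    a <= b * N -> b * N <= a + 1 -> c <= C * N -> C * N <= c + 1 ->
    let K := 6 + 4 * b + 6 * C in
  [/\ k * a + N * c + (k + N) ^+ 2 + 1 <= K * N ^+ 2,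
      `|k * a + N * c - C * (k + N) ^+ 2| <= K * (k * N),
      a + (k + N) + 1 <= K * N ^+ 2, `|a - b * (k + N)| <= K * k &
      c + (k + N) + 1 <= K * N ^+ 2 /\ `|c - C * (k + N)| <= K * k].
Proof.
move=> b0 C0 k1 kN a1 a2 c1 c2.
have k0 : 0 <= k by lra.
have N0 : 0 <= N by lra.
have N1 : 1 <= N by lra.
have NN : N <= N ^+ 2 by rewrite expr2 ler_peMl.
have ka : k * (b * N - a) <= k by rewrite ler_piMr//; lra.
have ka0 : 0 <= k * (b * N - a) by apply: mulr_ge0; lra.
have Nc : N * (C * N - c) <= N by rewrite ler_piMr//; lra.
have Nc0 : 0 <= N * (C * N - c) by apply: mulr_ge0; lra.
have kNN : k * N <= N ^+ 2 by rewrite expr2 ler_wpM2r.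
have kkN : k ^+ 2 <= k * N by rewrite expr2 ler_wpM2l.
have kN1 : k <= k * N by rewrite ler_peMr.
have NkN : N <= k * N by rewrite ler_peMl.
have bNN := ler_wpM2l (ltW b0) NN; have CNN := ler_wpM2l (ltW C0) NN.
have bkNN := ler_wpM2l (ltW b0) kNN; have CkNN := ler_wpM2l (ltW C0) kNN.
have Ckk := ler_wpM2l (ltW C0) kkN; have bkN1 := ler_wpM2l (ltW b0) kN1.
have Ckk0 := mulr_ge0 (ltW C0) (sqr_ge0 k).
have bN0 := mulr_ge0 (ltW b0) N0; have CN0 := mulr_ge0 (ltW C0) N0.
have bk0 := mulr_ge0 (ltW b0) k0; have Ck0 := mulr_ge0 (ltW C0) k0.
have bk1 := ler_wpM2l (ltW b0) k1; have Ck1 := ler_wpM2l (ltW C0) k1.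
split; [lra| |lra| |split; [lra|]];
by rewrite ler_norml; apply/andP; split; lra.
Qed.

Section Asymptotics.
Variables (R : realType) (delta B C : R).
Hypotheses (delta0 : 0 < delta) (delta1 : delta < 1) (B0 : 0 < B) (C0 : 0 < C).

Local Notation k := (barvinok_k delta).
Local Notation A n := (Num.truncn (B * C * n%:R)).
Local Notation c n := (Num.truncn (C * n%:R)).

Let BC0 : 0 < B * C. Proof. exact: mulr_gt0. Qed.

(** Common size of all remainders: about [n] logarithms of polynomial factors, and [k^2] terms from
    the corner and the quadratic errors. It is [o(k n)] for [0 < delta < 1]. *)
Definition error n : R := (n%:R + (k n)%:R ^+ 2) * (1 + ln n%:R).

(* Coefficient of [k n] in [ln T] when the entries of the two [k x n] blocks have
   mean [x]: their own entropy, minus what they take away from the [n x n] block,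
   whose mean drops to [C - x k / n]. *)
Definition block_gain (x : R) : R :=
  2 * tangent x x 1 - x * (ln (1 + C) - ln C).

Lemma k_bounds n : (0 < n)%N -> 1 <= ((k n)%:R : R) <= n%:R.
Proof.
move=> n0; have n1 : 1 <= n%:R :> R by rewrite ler1n.
have p1 : 1 <= n%:R `^ delta :> R.
  by have := ler_powR n1 (ltW delta0); rewrite powRr0.
apply/andP; split; first by rewrite ler1n truncn_gt0.
apply: (@le_trans _ _ (n%:R `^ delta)); first by rewrite truncn_le powR_ge0.
by have := ler_powR n1 (ltW delta1); rewrite powRr1.
Qed.

Lemma margin_bounds n :
  (A n)%:R <= B * C * n%:R < (A n)%:R + 1 /\ (c n)%:R <= C * n%:R < (c n)%:R + 1.
Proof.
by split; rewrite natr1 truncn_itv// mulr_ge0// ltW.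
Qed.

Lemma margin_lshift n (i : 'I_(k n)) : barvinok_margin B C (lshift n i) = A n.
Proof. by rewrite /barvinok_margin /= ltn_ord. Qed.

Lemma margin_rshift n (i : 'I_n) : barvinok_margin B C (rshift (k n) i) = c n.
Proof. by rewrite /barvinok_margin /= ltnNge leq_addr. Qed.

Lemma error_ge n : (0 < n)%N ->
  [/\ 0 <= ln (n%:R : R), (k n)%:R ^+ 2 + n%:R * (1 + ln n%:R) <= error n &
      (k n)%:R ^+ 2 * (1 + ln n%:R) <= error n].
Proof.
move=> n0; have l0 : 0 <= ln (n%:R : R) by rewrite ln_ge0// ler1n.
have N0 : 0 <= n%:R :> R by []; have k0 := sqr_ge0 ((k n)%:R : R).
rewrite /error; move: l0 N0 k0; set l := ln _; set K := (k n)%:R ^+ 2.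
by move=> l0 N0 k0; split=> //; nra.
Qed.

(** The quadratic remainder gives [K^2 / rho * d^2 / q]; the logarithm of [p + q + 1 <= K n^2] is at
    most [K + 2 ln n] and enters twice. *)
Lemma ln_compositions_le rho (K d : R) (n p q : nat) : 0 < rho -> 1 <= K ->
    (0 < n)%N -> (n <= q)%N -> p%:R + q%:R + 1 <= K * n%:R ^+ 2 ->
    `|p%:R - rho * q%:R| <= K * d ->
  `|ln ('C((p + q - 1)%N, (q - 1)%N)%:R : R) - tangent rho p%:R q%:R|
    <= (K ^+ 2 / rho + 2 * K + 4) * (d ^+ 2 / q%:R + 1 + ln n%:R).
Proof.
move=> rho0 K1 n0 nq pqK dK.
have K0 : 0 < K by exact: lt_le_trans K1.
have q0 : (0 < q)%N by exact: leq_trans nq.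
have qR0 : 0 < q%:R :> R by rewrite ltr0n.
have nR0 : 0 < n%:R :> R by rewrite ltr0n.
have l0 : 0 <= ln (n%:R : R) by rewrite ln_ge0// ler1n.
apply: le_trans (ln_compositions p rho0 q0) _.
have sq : (p%:R - rho * q%:R) ^+ 2 / (rho * (p%:R + q%:R))
    <= K ^+ 2 / rho * (d ^+ 2 / q%:R).
  have -> : K ^+ 2 / rho * (d ^+ 2 / q%:R) = (K * d) ^+ 2 / (rho * q%:R).
    by field; rewrite !gt_eqF.
  apply: ler_pM.
  - exact: sqr_ge0.
  - by rewrite invr_ge0 mulr_ge0 ?addr_ge0 // ltW.
  - rewrite -(real_normK (num_real (p%:R - _))) lerXn2r ?nnegrE//.
    exact: le_trans (normr_ge0 _) dK.
  - by rewrite lef_pV2 ?posrE ?mulr_gt0 ?ltr_wpDl// ler_pM2l// lerDr.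
have ln_le : ln ((p + q).+1%:R : R) <= K + 2 * ln n%:R.
  apply: (@le_trans _ _ (ln (K * n%:R ^+ 2))).
    by rewrite ler_ln ?posrE ?mulr_gt0 ?exprn_gt0// -natr1 natrD.
  rewrite lnM ?posrE ?exprn_gt0// lnXn// -(mulr_natl (ln _)) lerD2r.
  by rewrite ltW// ln_sublinear.
have d0 : 0 <= d ^+ 2 / q%:R by rewrite divr_ge0 ?sqr_ge0 ?ltW.
have Kr : 0 <= K ^+ 2 / rho by rewrite divr_ge0 ?sqr_ge0 ?ltW.
move: sq ln_le d0 Kr; set X := d ^+ 2 / _; set Y := K ^+ 2 / _ => sq ln_le d0 Kr.
have Yl : 0 <= Y * (1 + ln n%:R) by rewrite mulr_ge0 ?addr_ge0.
have KX : 0 <= K * (X + ln n%:R) by exact: mulr_ge0 (ltW K0) (addr_ge0 d0 l0).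
lra.
Qed.

(** The total is expanded at ratio [C] over [m^2] cells, the large and small margins at [B C] and
    [C] over [m = k + n] cells. Tangents are linear in the margins, so besides the expansion errors
    only floors and [k^2] terms remain. *)
Lemma ln_barvinok_G_approx : exists K : R, forall n, (0 < n)%N ->
  `|ln (barvinok_G delta B C n)
    - (n%:R ^+ 2 * tangent C C 1 + (k n)%:R * n%:R * block_gain (B * C))|
    <= K * error n.
Proof.
(* [K1] is the constant of [mixture_bounds], [K2] and [K3] those of [ln_compositions_le] at the
   ratios [C] and [B C]. *)
pose K1 : R := 6 + 4 * (B * C) + 6 * C.
pose K2 : R := K1 ^+ 2 / C + 2 * K1 + 4.
pose K3 : R := K1 ^+ 2 / (B * C) + 2 * K1 + 4.
have bC0 : 0 < B * C by exact: BC0.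
have K11 : 1 <= K1 by move: C0 bC0; rewrite /K1 => ? ?; lra.
have K10 : 0 <= K1 by exact: le_trans K11.
have K20 : 0 <= K2 by rewrite !addr_ge0// mulr_ge0 ?exprn_ge0 ?invr_ge0// ltW.
have K30 : 0 <= K3 by rewrite !addr_ge0// mulr_ge0 ?exprn_ge0 ?invr_ge0// ltW.
pose al := ln (1 + C) - ln C; pose al' := ln (1 + B * C) - ln (B * C).
pose be := ln (1 + C); pose be' := ln (1 + B * C).
exists (K2 + 2 * K3 + 2 * K2 + (2 * `|al| + `|be| + 2 * `|al'| + 2 * `|be'|)) => n n0.
have N1 : 1 <= n%:R :> R by rewrite ler1n.
have /andP[k1 kn] := k_bounds n0.
have [/andP[Ale Alt] /andP[cle clt]] := margin_bounds n.
have [l0 err1 err2] := error_ge n0.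
set m := (k n + n)%N.
have m0 : (0 < m)%N by rewrite /m addn_gt0 n0 orbT.
have mR : m%:R = (k n)%:R + n%:R :> R by rewrite natrD.
have nm : (n <= m)%N by rewrite leq_addl.
pose S := (k n * A n + n * c n)%N.
have SR : S%:R = (k n)%:R * (A n)%:R + n%:R * (c n)%:R :> R by rewrite natrD !natrM.
pose T p q : R := ln ('C((p + q - 1)%N, (q - 1)%N)%:R).
have lnG : ln (barvinok_G delta B C n)
    = - T S (m * m)%N + 2 * ((k n)%:R * T (A n) m + n%:R * T (c n) m).
  rewrite /barvinok_G /indep_estimate -/m.
  have -> : (\sum_(i < m) barvinok_margin B C i = S)%N.
    rewrite big_split_ord/= (eq_bigr (fun=> A n)) => [|i _]; last exact: margin_lshift.
    rewrite [X in (_ + X)%N](eq_bigr (fun=> c n)) => [|i _]; last exact: margin_rshift.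
    by rewrite !sum_nat_const !card_ord.
  have prodE : \prod_(i < m) 'C((barvinok_margin B C i + m - 1)%N, (m - 1)%N)%:R
    = 'C((A n + m - 1)%N, (m - 1)%N)%:R ^+ k n
        * 'C((c n + m - 1)%N, (m - 1)%N)%:R ^+ n :> R.
    rewrite big_split_ord/= (eq_bigr (fun=> 'C((A n + m - 1)%N, (m - 1)%N)%:R)) => [|i _].
      rewrite [X in _ * X](eq_bigr (fun=> 'C((c n + m - 1)%N, (m - 1)%N)%:R)) => [|i _].
        by rewrite !prodr_const !card_ord.
      by rewrite margin_rshift.
    by rewrite margin_lshift.
  have pos := compositions_gt0 R.
  rewrite prodE -mulrA lnM ?posrE ?invr_gt0 ?mulr_gt0 ?exprn_gt0 ?pos//.
  rewrite lnV ?posrE ?pos// lnM ?posrE ?mulr_gt0 ?exprn_gt0 ?pos//.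
  rewrite lnM ?posrE ?exprn_gt0 ?pos// !lnXn ?pos// -/(T _ _) -/(T _ _) -/(T _ _).
  by rewrite -(mulr_natl (T (A n) m)) -(mulr_natl (T (c n) m)); ring.
have kR0 : 0 <= (k n)%:R :> R by [].
have mN : n%:R <= m%:R :> R by rewrite ler_nat.
have mR0 : 0 < m%:R :> R by rewrite ltr0n.
have [S1 S2 a1 a2 [c1 c2]] := mixture_bounds bC0 C0 k1 kn Ale (ltW Alt) cle (ltW clt).
have e1 : `|T S (m * m)%N - tangent C S%:R (m * m)%:R| <= K2 * error n.
  apply: le_trans (ln_compositions_le (n := n) (d := (k n)%:R * n%:R) C0 K11 n0 _ _ _) _.
  - by rewrite (leq_trans nm)// leq_pmulr.
  - by rewrite natrM SR mR -expr2.
  - by rewrite natrM SR mR -expr2.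
  - rewrite ler_wpM2l//.
    have : ((k n)%:R * n%:R) ^+ 2 / (m * m)%:R <= (k n)%:R ^+ 2 :> R.
      rewrite ler_pdivrMr ?ltr0n ?muln_gt0 ?m0// natrM exprMn ler_wpM2l ?sqr_ge0//.
      by rewrite expr2 ler_pM.
    have := ler_peMl (_ : 0 <= 1 + ln n%:R) N1; move/(_ (addr_ge0 ler01 l0)); lra.
have e2 : `|T (A n) m - tangent (B * C) (A n)%:R m%:R|
    <= K3 * ((k n)%:R ^+ 2 / m%:R + 1 + ln n%:R).
  by apply: ln_compositions_le => //; rewrite mR.
have e3 : `|T (c n) m - tangent C (c n)%:R m%:R|
    <= K2 * ((k n)%:R ^+ 2 / m%:R + 1 + ln n%:R).
  by apply: ln_compositions_le => //; rewrite mR.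
have err0 : n%:R + (k n)%:R ^+ 2 <= error n.
  by have := mulr_ge0 (ler0n R n) l0; lra.
have N_err : n%:R <= error n by have := sqr_ge0 ((k n)%:R : R); lra.
have kk_err : (k n)%:R ^+ 2 <= error n by lra.
have e_err : n%:R * ((k n)%:R ^+ 2 / m%:R + 1 + ln n%:R) <= error n.
  have : n%:R * ((k n)%:R ^+ 2 / m%:R) <= (k n)%:R ^+ 2 :> R.
    by rewrite mulrA ler_pdivrMr// mulrC ler_wpM2l ?sqr_ge0.
  lra.
have e_ge0 : 0 <= (k n)%:R ^+ 2 / m%:R + 1 + ln (n%:R : R).
  by rewrite !addr_ge0 ?divr_ge0 ?sqr_ge0.
have scale (w K y : R) : 0 <= w <= n%:R -> 0 <= K ->
    `|y| <= K * ((k n)%:R ^+ 2 / m%:R + 1 + ln n%:R) -> `|w * y| <= K * error n.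
  move=> /andP[w0 wN] Kp yK; rewrite normrM ger0_norm//.
  apply: le_trans (ler_wpM2l w0 yK) _; rewrite mulrCA ler_wpM2l//.
  by apply: le_trans e_err; rewrite ler_wpM2r.
have bounded (w y : R) : `|w| <= error n -> `|w * y| <= `|y| * error n.
  by move=> wK; rewrite normrM mulrC ler_wpM2l.
have e2' := scale (k n)%:R _ _ (introT andP (conj kR0 kn)) K30 e2.
have e3' := scale n%:R _ _ (introT andP (conj (ler0n _ _) (lexx _))) K20 e3.
have w1 : `|n%:R * ((c n)%:R - C * n%:R)| <= error n.
  rewrite normrM ger0_norm// (le_trans _ N_err)// ler_piMr//.
  by rewrite ler_norml; apply/andP; split; lra.
have w2 : `|(k n)%:R * ((A n)%:R - B * C * n%:R)| <= error n.
  rewrite normrM ger0_norm// (le_trans _ N_err)// (le_trans _ kn)// ler_piMr//.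
  by rewrite ler_norml; apply/andP; split; lra.
have w3 : `|(k n)%:R ^+ 2| <= error n by rewrite ger0_norm ?sqr_ge0.
(* An exact splitting into expansion errors, effects of the floors and terms in [k^2], each bounded
   by a multiple of [error]. *)
have -> : ln (barvinok_G delta B C n)
    - (n%:R ^+ 2 * tangent C C 1 + (k n)%:R * n%:R * block_gain (B * C))
  = - (T S (m * m)%N - tangent C S%:R (m * m)%:R)
    + (k n)%:R * (T (A n) m - tangent (B * C) (A n)%:R m%:R) *+ 2
    + n%:R * (T (c n) m - tangent C (c n)%:R m%:R) *+ 2
    + n%:R * ((c n)%:R - C * n%:R) * al
    + - ((k n)%:R * ((A n)%:R - B * C * n%:R) * al)
    + - ((k n)%:R ^+ 2 * be)
    + (k n)%:R * ((A n)%:R - B * C * n%:R) * al' *+ 2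
    + (k n)%:R ^+ 2 * be' *+ 2.
  rewrite lnG natrM mR SR /block_gain /tangent -/al -/al' -/be -/be'; ring.
have -> : (K2 + 2 * K3 + 2 * K2 + (2 * `|al| + `|be| + 2 * `|al'| + 2 * `|be'|))
    * error n = K2 * error n + (K3 * error n) *+ 2 + (K2 * error n) *+ 2
    + `|al| * error n + `|al| * error n + `|be| * error n
    + (`|al'| * error n) *+ 2 + (`|be'| * error n) *+ 2 by ring.
do ! (apply: (le_trans (ler_normD _ _)); apply: lerD);
  by rewrite ?normrN ?normrMn ?lerMn2r//=; exact: bounded.
Qed.

End Asymptotics.

(** * Expansions of the number of tables *)

Lemma ln_prod (R : realType) (I : finType) (F : I -> R) :
  (forall i, 0 < F i) -> ln (\prod_i F i) = \sum_i ln (F i).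
Proof.
move=> F0; suff [] : 0 < \prod_i F i /\ ln (\prod_i F i) = \sum_i ln (F i) by [].
elim/big_rec2: _ => [|i y x _ [x0 <-]]; first by rewrite ln1.
by rewrite mulr_gt0// lnM ?posrE.
Qed.

Section TableAsymptotics.
Variables (R : realType) (delta B C : R).
Hypotheses (delta0 : 0 < delta) (delta1 : delta < 1) (B0 : 0 < B) (C0 : 0 < C).

Local Notation k := (barvinok_k delta).
Local Notation A n := (Num.truncn (B * C * n%:R)).
Local Notation c n := (Num.truncn (C * n%:R)).

Let BC0 : 0 < B * C. Proof. exact: mulr_gt0. Qed.

(** The rows of the [k x n] block get the sum [r], the floor of [x n], which [x <= B C] allows. The
    bound [x k + 2 <= C n] keeps its column sums [q] within the small margins. *)
Lemma ln_barvinok_T_lower (x : R) : 0 < x -> x <= B * C ->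
  exists K : R, forall n, (0 < n)%N -> x * (k n)%:R + 2 <= C * n%:R ->
  (0 < barvinok_T delta B C n)%N /\
  n%:R ^+ 2 * tangent C C 1 + (k n)%:R * n%:R * block_gain C x - K * error delta n
    <= ln (barvinok_T delta B C n)%:R.
Proof.
move=> x0 xBC.
pose K1 : R := 6 + 4 * x + 6 * C.
pose Kx : R := K1 ^+ 2 / x + 2 * K1 + 4.
pose KC : R := K1 ^+ 2 / C + 2 * K1 + 4.
pose al := ln (1 + C) - ln C; pose alx := ln (1 + x) - ln x.
have K11 : 1 <= K1 by move: C0 x0; rewrite /K1 => ? ?; lra.
have K10 : 0 <= K1 by exact: le_trans K11.
have Kx0 : 0 <= Kx by rewrite !addr_ge0// mulr_ge0 ?exprn_ge0 ?invr_ge0// ltW.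
have KC0 : 0 <= KC by rewrite !addr_ge0// mulr_ge0 ?exprn_ge0 ?invr_ge0// ltW.
(* [2 Kx] serves the two [k x n] blocks, [KC] the [n x n] block, [6 + x + C] the numbers of column
   sums, the rest the floors. *)
exists (2 * Kx + KC + (6 + x + C) + (2 * `|alx| + 2 * `|al|)) => n n0 xkC.
have N0 : 0 < n%:R :> R by rewrite ltr0n.
have N1 : 1 <= n%:R :> R by rewrite ler1n.
have /andP[k1 kN] := k_bounds delta0 delta1 n0.
have [_ /andP[cle clt]] := margin_bounds B0 C0 n.
have [l0 err1 _] := error_ge delta n0.
set r := Num.truncn (x * n%:R).
have /andP[rle rlt] : r%:R <= x * n%:R < r%:R + 1.
  by rewrite natr1 truncn_itv// mulr_ge0// ltW.
have rA : (r <= A n)%N by apply: le_truncn; rewrite ler_wpM2r.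
have [q [qlt sumq lower]] := num_tables_lower (k n) (c n) n0 rA.
have qx j : (q j)%:R <= 1 + x * (k n)%:R.
  rewrite -(ler_pM2l N0); have := qlt j; rewrite -(ltr_nat R) natrD !natrM => /ltW.
  have := ler_wpM2l (ler0n R (k n)) rle; lra.
have qc j : (q j <= c n)%N.
  by rewrite -(ler_nat R); have := qx j; lra.
have {}lower : ('C(r + n - 1, n - 1) ^ (2 * k n)
    * \prod_j 'C(c n - q j + n - 1, n - 1)
    <= barvinok_T delta B C n * ((k n * r).+1 * (n * c n).+1) ^ n)%N := lower qc.
have pos p := compositions_gt0 R p n.
have T0 : (0 < barvinok_T delta B C n)%N.
  rewrite lt0n; apply/eqP => T0; move: lower; rewrite T0 mul0n leqNgt => /negP; apply.
  rewrite muln_gt0 expn_gt0 -(ltr0n R) pos /=.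
  by apply: prodn_gt0 => j; rewrite -(ltr0n R) pos.
split=> //.
set T := barvinok_T delta B C n in T0 *.
have TR0 : 0 < T%:R :> R by rewrite ltr0n.
have lnlower : 2 * (k n)%:R * ln ('C((r + n - 1)%N, (n - 1)%N)%:R : R)
    + \sum_j ln ('C((c n - q j + n - 1)%N, (n - 1)%N)%:R : R)
    <= ln T%:R + n%:R * (ln ((k n * r).+1%:R : R) + ln ((n * c n).+1%:R : R)).
  rewrite -ln_prod => [|j]; last exact: pos.
  have -> : 2 * (k n)%:R * ln ('C((r + n - 1)%N, (n - 1)%N)%:R : R)
      = ln (('C((r + n - 1)%N, (n - 1)%N) ^ (2 * k n))%:R).
    by rewrite natrX lnXn// -(mulr_natl (ln _)) natrM.
  have -> : n%:R * (ln ((k n * r).+1%:R : R) + ln ((n * c n).+1%:R : R))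
      = ln ((((k n * r).+1 * (n * c n).+1) ^ n)%:R).
    rewrite natrX lnXn ?ltr0n// -(mulr_natl (ln _)) natrM lnM ?posrE ?ltr0n//.
  have P1 : 0 < ('C((r + n - 1)%N, (n - 1)%N) ^ (2 * k n))%:R :> R.
    by rewrite natrX exprn_gt0.
  have P2 : 0 < \prod_(i < n) ('C((c n - q i + n - 1)%N, (n - 1)%N)%:R : R).
    by apply: prodr_gt0.
  have P3 : 0 < ((((k n * r).+1 * (n * c n).+1) ^ n)%N%:R : R).
    by rewrite ltr0n expn_gt0.
  rewrite -!lnM ?posrE// ler_ln ?posrE ?mulr_gt0//.
  by rewrite -natr_prod -!natrM ler_nat; exact: lower.
set e : R := (k n)%:R ^+ 2 / n%:R + 1 + ln n%:R.
have e_err : n%:R * e <= error delta n.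
  rewrite /e (_ : _ * _ = (k n)%:R ^+ 2 + n%:R * (1 + ln n%:R))//.
  by field; rewrite gt_eqF.
have e0 : 0 <= e by rewrite !addr_ge0 ?divr_ge0 ?sqr_ge0.
have k0 : 0 <= (k n)%:R :> R by [].
have ke_err : (k n)%:R * e <= error delta n.
  by apply: le_trans e_err; rewrite ler_wpM2r.
have NN : n%:R <= n%:R ^+ 2 :> R by rewrite expr2 ler_peMl// ltW.
have xk : x <= x * (k n)%:R by rewrite ler_peMr// ltW.
have Ck : C <= C * (k n)%:R by rewrite ler_peMr// ltW.
have xNN : x * n%:R <= x * n%:R ^+ 2 by rewrite ler_wpM2l// ltW.
have CNN : C * n%:R <= C * n%:R ^+ 2 by rewrite ler_wpM2l// ltW.
have CN0 : 0 <= C * n%:R ^+ 2 by rewrite mulr_ge0 ?sqr_ge0// ltW.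
have xN0 : 0 <= x * n%:R ^+ 2 by rewrite mulr_ge0 ?sqr_ge0// ltW.
have Ck0 : 0 <= C * (k n)%:R by rewrite mulr_ge0// ltW.
have xk0 : 0 <= x * (k n)%:R by rewrite mulr_ge0// ltW.
have h1 : tangent x r%:R n%:R - Kx * e <= ln ('C((r + n - 1)%N, (n - 1)%N)%:R : R).
  have : `|ln ('C((r + n - 1)%N, (n - 1)%N)%:R : R) - tangent x r%:R n%:R| <= Kx * e.
    apply: ln_compositions_le => //; first by rewrite /K1; lra.
    by rewrite /K1 ler_norml; apply/andP; split; lra.
  by rewrite ler_norml => /andP[+ _]; rewrite lerBrDr addrC.
have h2 j : tangent C (c n - q j)%:R n%:R - KC * e
    <= ln ('C((c n - q j + n - 1)%N, (n - 1)%N)%:R : R).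
  have : `|ln ('C((c n - q j + n - 1)%N, (n - 1)%N)%:R : R)
      - tangent C (c n - q j)%:R n%:R| <= KC * e.
    have qj := qx j; have qj0 : 0 <= (q j)%:R :> R by [].
    apply: ln_compositions_le => //; rewrite natrB//; first by rewrite /K1; lra.
    by rewrite /K1 ler_norml; apply/andP; split; lra.
  by rewrite ler_norml => /andP[+ _]; rewrite lerBrDr addrC.
(* The tangent is linear, so of [q] only its total [k r] matters. *)
have sum_tangent : \sum_j (tangent C (c n - q j)%:R n%:R - KC * e)
    = (n%:R * (c n)%:R - (k n)%:R * r%:R) * al + n%:R * n%:R * ln (1 + C)
      - n%:R * (KC * e).
  rewrite (eq_bigr (fun j =>
      ((c n)%:R * al + n%:R * ln (1 + C) - KC * e) - (q j)%:R * al)) => [|j _].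
    rewrite sumrB sumr_const card_ord -mulr_suml -natr_sum sumq natrM.
    by rewrite -[_ *+ n]mulr_natl; ring.
  by rewrite /tangent natrB// -/al; ring.
have h2sum : \sum_j (tangent C (c n - q j)%:R n%:R - KC * e)
    <= \sum_j ln ('C((c n - q j + n - 1)%N, (n - 1)%N)%:R : R).
  by apply: ler_sum => j _; exact: h2.
rewrite sum_tangent in h2sum.
have ln_le (p : nat) (z : R) : 0 < z -> p%:R + 1 <= z * n%:R ^+ 2 ->
    ln (p.+1%:R : R) <= z + 2 * ln n%:R.
  move=> z0 pz; apply: (@le_trans _ _ (ln (z * n%:R ^+ 2))).
    by rewrite ler_ln ?posrE ?mulr_gt0 ?exprn_gt0// -natr1.
  rewrite lnM ?posrE ?exprn_gt0// lnXn// -(mulr_natl (ln _)) lerD2r.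
  by rewrite ltW// ln_sublinear.
have h3 : ln ((k n * r).+1%:R : R) <= 1 + x + 2 * ln n%:R.
  apply: ln_le; first by rewrite addr_gt0.
  have := ler_pM k0 (ler0n R r) kN rle; rewrite natrM; lra.
have h4 : ln ((n * c n).+1%:R : R) <= 1 + C + 2 * ln n%:R.
  apply: ln_le; first by rewrite addr_gt0.
  have := ler_wpM2l (ltW N0) cle; rewrite natrM; lra.
have err0 : n%:R + n%:R * ln n%:R <= error delta n.
  by have := sqr_ge0 ((k n)%:R : R); lra.
have Nl0 : 0 <= n%:R * ln (n%:R : R) by rewrite mulr_ge0.
have bounded (w y : R) : `|w| <= error delta n ->
    - (`|y| * error delta n) <= w * y <= `|y| * error delta n.
  by move=> wK; rewrite -ler_norml normrM mulrC ler_wpM2l.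
have N_err : n%:R <= error delta n by lra.
have /bounded w1 : `|n%:R * ((c n)%:R - C * n%:R)| <= error delta n.
  rewrite normrM ger0_norm// (le_trans _ N_err)// ler_piMr//.
  by rewrite ler_norml; apply/andP; split; lra.
have /bounded w2 : `|(k n)%:R * (r%:R - x * n%:R)| <= error delta n.
  rewrite normrM ger0_norm// (le_trans _ N_err)// (le_trans _ kN)// ler_piMr//.
  by rewrite ler_norml; apply/andP; split; lra.
have := w1 al; have := w2 al; have := w2 alx.
have := ler_wpM2l k0 h1; have := ler_wpM2l Kx0 ke_err; have := ler_wpM2l KC0 e_err.
have : n%:R * (ln ((k n * r).+1%:R : R) + ln ((n * c n).+1%:R : R))
    <= (6 + x + C) * error delta n.
  have : 0 <= x + C by rewrite addr_ge0 ?ltW.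
  move=> /ler_wpM2l /(_ _ _ N_err); have := ler_wpM2l (ltW N0) h3.
  have := ler_wpM2l (ltW N0) h4; lra.
move: lnlower h2sum; rewrite /block_gain /tangent -/al -/alx.
set L1 := ln (_ : R); set L2 := ln T%:R; set L3 := _ * (_ + ln _).
set S1 := \sum_j _; move: L1 L2 L3 S1 => L1 L2 L3 S1.
lra.
Qed.

(** A weight [z] corresponds to geometric entries of mean [z / (1 - z)]: [s^2] gives mean [C], [s t]
    mean [x]. The last hypothesis is complementary slackness: either [x = B C], or [t = 1] and the
    part of the large margins beyond [x n] costs nothing at this order. *)
Lemma ln_barvinok_T_upper (s t x : R) : 0 < s -> 0 < t <= 1 -> 0 < x ->
    s ^+ 2 = C / (1 + C) -> s * t = x / (1 + x) -> (B * C - x) * ln t = 0 ->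
  exists K : R, forall n, (0 < n)%N -> (0 < barvinok_T delta B C n)%N ->
  ln (barvinok_T delta B C n)%:R <=
    n%:R ^+ 2 * tangent C C 1 + (k n)%:R * n%:R * block_gain C x + K * error delta n.
Proof.
move=> s0 /andP[t0 t1] x0 s2 st slack.
(* [2 B C] pays for [u] in place of [t], in rows and in columns; [1] pays for the [k x k] corner. *)
exists (2 * (B * C) + 1) => n n0 T0.
have N0 : 0 < n%:R :> R by rewrite ltr0n.
have N1 : 1 <= n%:R :> R by rewrite ler1n.
have N10 : 0 < n%:R + 1 :> R by rewrite addr_gt0.
have /andP[k1 kN] := k_bounds delta0 delta1 n0.
have [/andP[Ale _] /andP[cle _]] := margin_bounds B0 C0 n.
have [l0 err1 err2] := error_ge delta n0.
have C10 : 0 < 1 + C by rewrite addr_gt0.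
have x10 : 0 < 1 + x by rewrite addr_gt0.
(* [t = 1] in the supercritical case, where [1 - t^2] has to be kept away from 0 *)
pose u := t * (n%:R / (n%:R + 1)).
have u0 : 0 < u by rewrite mulr_gt0// divr_gt0.
have ut : u < t by rewrite gtr_pMr// ltr_pdivrMr// mul1r ltrDl.
have u1 : u < 1 by exact: lt_le_trans t1.
have s1 : s < 1.
  rewrite -(@expr_lt1 _ 2) ?ltW// s2 ltr_pdivrMr// mul1r ltrDr//.
pose y (i : 'I_(k n + n)) := if (i < k n)%N then u else s.
have yL i : y (lshift n i) = u by rewrite /y /= ltn_ord.
have yR i : y (rshift (k n) i) = s by rewrite /y /= ltnNge leq_addr.
have y01 i : 0 < y i < 1 by rewrite /y; case: ifP; rewrite ?u0 ?u1 ?s0 ?s1.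
have yy i j : 0 < y i * y j < 1.
  have /andP[yi0 yi1] := y01 i; have /andP[yj0 yj1] := y01 j.
  by rewrite mulr_gt0//= mulr_ilt1 ?ltW.
have /= := num_tables_weight_le (@barvinok_margin R delta B C n) (@barvinok_margin R delta B C n) yy.
rewrite -[num_tables _ _]/(barvinok_T delta B C n).
set F := fun i : 'I_(k n + n) => \prod_j (1 - y i * y j)^-1.
have -> : \prod_(i < k n + n) F i
    = (((1 - u * u)^-1) ^+ k n * ((1 - u * s)^-1) ^+ n) ^+ k n
      * (((1 - u * s)^-1) ^+ k n * ((1 - s * s)^-1) ^+ n) ^+ n.
  have FE i : F i = ((1 - y i * u)^-1) ^+ k n * ((1 - y i * s)^-1) ^+ n.
    rewrite /F big_split_ord/=.
    under eq_bigr do rewrite yL.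
    under [X in _ * X]eq_bigr do rewrite yR.
    by rewrite !prodr_const !card_ord.
  rewrite big_split_ord/=.
  under eq_bigr do rewrite FE yL.
  under [X in _ * X]eq_bigr do rewrite FE yR.
  by rewrite !prodr_const !card_ord [s * u]mulrC.
have -> : \prod_(i < k n + n) y i ^+ barvinok_margin B C i
    = u ^+ (A n * k n) * s ^+ (c n * n).
  rewrite big_split_ord/=.
  under eq_bigr do rewrite yL margin_lshift.
  under [X in _ * X]eq_bigr do rewrite yR margin_rshift.
  by rewrite !prodr_const !card_ord -!exprM.
set T := barvinok_T delta B C n in T0 *.
have TR0 : 0 < T%:R :> R by rewrite ltr0n.
have uu1 : 0 < 1 - u * u by rewrite subr_gt0 mulr_ilt1 ?ltW.
have us1 : 0 < 1 - u * s by rewrite subr_gt0 mulr_ilt1 ?ltW.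
have ss1 : 0 < 1 - s * s by rewrite subr_gt0 mulr_ilt1 ?ltW.
rewrite -ler_ln ?posrE ?mulr_gt0 ?exprn_gt0 ?mulr_gt0 ?exprn_gt0 ?invr_gt0//.
rewrite !(lnM, lnXn, lnV) ?posrE ?mulr_gt0 ?exprn_gt0 ?mulr_gt0 ?exprn_gt0 ?invr_gt0//.
rewrite !(mulrnDl, mulNrn) -!mulrnA -!(mulr_natl (ln _)) !natrM.
have lnN1 : 0 <= n%:R * (ln (n%:R + 1) - ln (n%:R : R)) <= 1.
  have : ln ((n%:R + 1) / n%:R : R) <= (n%:R + 1) / n%:R - 1.
    by apply: ln_le_subr1; rewrite divr_gt0.
  rewrite ln_div ?posrE// => /(ler_wpM2l (ltW N0)).
  rewrite (_ : n%:R * ((n%:R + 1) / n%:R - 1) = 1 :> R) => [->|]; last first.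
    by field; rewrite gt_eqF.
  by rewrite andbT mulr_ge0// subr_ge0 ler_ln ?posrE// lerDl.
have lt0 : ln t <= 0 by exact: ln_le0.
have ls2 : 2 * ln s = ln C - ln (1 + C).
  by rewrite -ln_div ?posrE// -s2 lnXn// -(mulr_natl (ln s)).
have lst : ln t + ln s = ln x - ln (1 + x).
  by rewrite -ln_div ?posrE// -st lnM ?posrE// addrC.
(* The corner weight is at least [1 / (n + 1)] below 1, so its [k^2] factors cost at most
   [k^2 (1 + ln n)]. *)
have luu : - ln (1 - u * u) <= 1 + ln n%:R.
  have : (n%:R + 1)^-1 <= 1 - u * u.
    have uN : u <= n%:R / (n%:R + 1) by rewrite ler_piMl// divr_ge0// ltW.
    have : u * u <= n%:R / (n%:R + 1) by apply: le_trans uN; rewrite ler_piMl// ltW.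
    have E : (n%:R + 1)^-1 = 1 - n%:R / (n%:R + 1) :> R by field; rewrite gt_eqF.
    by move=> uuN; rewrite [leLHS]E lerD2l lerN2.
  rewrite -ler_ln ?posrE ?invr_gt0// lnV ?posrE//.
  have : ln (n%:R + 1 : R) - ln n%:R <= 1.
    case/andP: lnN1 => lnN0 lnN1; apply: le_trans lnN1; rewrite ler_peMl//.
    by rewrite subr_ge0 ler_ln ?posrE// lerDl.
  lra.
have lus : - ln (1 - u * s) <= ln (1 + x).
  have : (1 + x)^-1 <= 1 - u * s.
    have -> : (1 + x)^-1 = 1 - s * t by rewrite st; field; rewrite gt_eqF.
    by rewrite lerD2l lerN2 mulrC ler_wpM2l// ltW.
  by rewrite -ler_ln ?posrE ?invr_gt0// lnV ?posrE//; lra.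
have lss : ln (1 - s * s) = - ln (1 + C).
  rewrite -lnV ?posrE// -expr2 s2; congr ln; field; rewrite gt_eqF//.
set a : R := (A n)%:R in Ale *; set b : R := (c n)%:R in cle *.
have a0 : 0 <= (k n)%:R * a by rewrite mulr_ge0.
have F1 : (k n)%:R * a * (ln (n%:R + 1) - ln n%:R) <= B * C * (k n)%:R.
  case/andP: lnN1 => lnN0 lnN1.
  have : 0 <= ln (n%:R + 1 : R) - ln n%:R by rewrite subr_ge0 ler_ln ?posrE// lerDl.
  move=> /ler_wpM2l /(_ _ _ (ler_wpM2l (ler0n R (k n)) Ale)).
  have := ler_wpM2l (mulr_ge0 (ltW BC0) (ler0n R (k n))) lnN1; lra.
(* Slackness lets [x] stand for [B C]; the floor then goes the right way because [ln t <= 0]. *)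
have F2 : - ((k n)%:R * a * ln t) <= - (x * (k n)%:R * n%:R * ln t).
  have -> : x * (k n)%:R * n%:R * ln t = (k n)%:R * (B * C * n%:R) * ln t.
    have : (k n)%:R * n%:R * ((B * C - x) * ln t) = 0 by rewrite slack mulr0.
    lra.
  by rewrite lerN2 ler_wnM2r// ler_wpM2l.
have F3 : - (b * n%:R * (2 * ln s)) <= - (C * n%:R ^+ 2 * (2 * ln s)).
  rewrite lerN2 ler_wnM2r//; last by rewrite expr2 mulrA ler_wpM2r.
  by rewrite mulr_ge0_le0// ln_le0// ltW.
have F4 := ler_wpM2l (sqr_ge0 ((k n)%:R : R)) luu.
have F5 := ler_wpM2l (mulr_ge0 (ler0n R (k n)) (ler0n R n)) lus.
have F6 : B * C * (k n)%:R <= B * C * error delta n.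
  apply: ler_wpM2l; first exact: ltW.
  have := sqr_ge0 ((k n)%:R : R).
  have := mulr_ge0 (ler0n R n) l0; lra.
have F7 : x * (k n)%:R * n%:R * (ln t + ln s)
    = x * (k n)%:R * n%:R * (ln x - ln (1 + x)) by rewrite lst.
have F8 : x * (k n)%:R * n%:R * (2 * ln s)
    = x * (k n)%:R * n%:R * (ln C - ln (1 + C)) by rewrite ls2.
have F9 : b * n%:R * (2 * ln s) = b * n%:R * (ln C - ln (1 + C)) by rewrite ls2.
rewrite ls2 in F3; rewrite lss /block_gain /tangent.
lra.
Qed.

End TableAsymptotics.

(** * Passage to the limit *)

Lemma near_le_powR (R : realType) (theta y : R) : 0 < theta ->
  \forall n \near \oo, y <= n%:R `^ theta.
Proof.
move=> theta0; near=> n; apply: le_trans (ler_norm y) _.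
have -> : `|y| = (`|y| `^ theta^-1) `^ theta.
  by rewrite -powRrM mulVf ?gt_eqF// powRr1.
apply: ge0_ler_powR; rewrite ?nnegrE ?powR_ge0//; first exact: ltW.
by near: n; exact: nbhs_infty_ger.
Unshelve. all: by end_near. Qed.

Section Limit.
Variables (R : realType) (delta B C : R).
Hypotheses (delta0 : 0 < delta) (delta1 : delta < 1) (B0 : 0 < B) (C0 : 0 < C).

Local Notation k := (barvinok_k delta).

Lemma barvinok_G_gt0 n : 0 < barvinok_G delta B C n.
Proof.
have pos := compositions_gt0 R.
rewrite /barvinok_G /indep_estimate !mulr_gt0 ?invr_gt0 ?pos//;
  by apply: prodr_gt0 => i _; exact: pos.
Qed.

Lemma near_k_small (x : R) : 0 < x ->
  \forall n \near \oo, x * (k n)%:R + 2 <= C * n%:R.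
Proof.
move=> x0; have d10 : 0 < 1 - delta by rewrite subr_gt0.
near=> n.
have n0 : (0 < n)%N by near: n; exact: nbhs_infty_gt.
have kle : (k n)%:R <= n%:R `^ delta by rewrite truncn_le powR_ge0.
have big : (x + 2) / C <= n%:R `^ (1 - delta) by near: n; exact: near_le_powR.
have d1 : 1 <= n%:R `^ delta :> R.
  by have := ler_powR (_ : 1 <= n%:R) (ltW delta0); rewrite powRr0 ler1n; apply.
have -> : n%:R = n%:R `^ (1 - delta) * n%:R `^ delta.
  by rewrite -powRD ?subrK ?powRr1// pnatr_eq0 -lt0n n0 implybT.
apply: (@le_trans _ _ ((x + 2) * n%:R `^ delta)).
  have := ler_wpM2l (ltW x0) kle; lra.
by rewrite mulrA ler_wpM2r ?powR_ge0// mulrC -ler_pdivrMr.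
Unshelve. all: by end_near. Qed.

(** Both [n] and [k^2] are at most [n ^ (1 + delta - 2 eta)], and [1 + ln n] is at most
    [(1 + 1 / eta) n ^ eta]; a factor [n ^ eta] is left to spare. *)
Lemma error_powR_le (eta : R) n : (0 < n)%N -> 0 < eta ->
    2 * eta <= delta -> 2 * eta <= 1 - delta ->
  error delta n * n%:R `^ eta <= 2 * (1 + eta^-1) * n%:R `^ (1 + delta).
Proof.
move=> n0 eta0 eta1 eta2.
have N1 : 1 <= n%:R :> R by rewrite ler1n.
have N0 : 0 < n%:R :> R by rewrite ltr0n.
have D r q : n%:R `^ (r + q) = n%:R `^ r * n%:R `^ q :> R.
  by rewrite powRD// (gt_eqF N0) implybT.
have eta_ge1 : 1 <= n%:R `^ eta :> R.
  by have := ler_powR N1 (ltW eta0); rewrite powRr0.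
have l0 : 0 <= ln (n%:R : R) by rewrite ln_ge0.
have lnle : 1 + ln n%:R <= (1 + eta^-1) * n%:R `^ eta.
  have := ln_sublinear (powR_gt0 eta N0); rewrite ln_powR => /ltW.
  rewrite -ler_pdivlMl// => ?; rewrite mulrDl mul1r; exact: lerD.
pose P : R := n%:R `^ (1 + delta - 2 * eta).
have P1 : n%:R <= P.
  by rewrite -[leLHS]powRr1 ?ler0n// ler_powR//; lra.
have P2 : (k n)%:R ^+ 2 <= P.
  have kle : (k n)%:R <= n%:R `^ delta :> R by rewrite truncn_le powR_ge0.
  apply: (@le_trans _ _ (n%:R `^ (delta + delta))).
    by rewrite D expr2 ler_pM.
  by rewrite ler_powR//; lra.
have -> : 2 * (1 + eta^-1) * n%:R `^ (1 + delta)
    = (P + P) * ((1 + eta^-1) * n%:R `^ eta) * n%:R `^ eta.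
  rewrite (_ : 1 + delta = (1 + delta - 2 * eta) + (eta + eta)); last by ring.
  by rewrite (D (1 + delta - 2 * eta)) (D eta) -/P; ring.
rewrite ler_wpM2r ?powR_ge0// /error ler_pM ?addr_ge0 ?sqr_ge0//.
exact: lerD.
Qed.

(* [x] is the mean entry of the optimal [k x n] block, capped at [B C]; [s ^ 2]
   and [s t] are the optimal weights of the two kinds of blocks. *)
Lemma ln_ratio_cvg (s t x : R) : 0 < s -> 0 < t <= 1 -> 0 < x -> x <= B * C ->
    s ^+ 2 = C / (1 + C) -> s * t = x / (1 + x) -> (B * C - x) * ln t = 0 ->
  (fun n : nat => 1 / ((n%:R : R) `^ (1 + delta)) *
      ln ((barvinok_T delta B C n)%:R / barvinok_G delta B C n))
    @ \oo --> block_gain C x - block_gain C (B * C).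
Proof.
move=> s0 t01 x0 xBC s2 st slack.
have [K1 upper] := ln_barvinok_T_upper delta0 delta1 B0 C0 s0 t01 x0 s2 st slack.
have [K2 lower] := ln_barvinok_T_lower delta0 delta1 B0 C0 x0 xBC.
have [K3 approx] := ln_barvinok_G_approx delta0 delta1 B0 C0.
set D := block_gain C x - block_gain C (B * C).
(* The largest saving that [error_powR_le] permits. *)
pose eta := Num.min delta (1 - delta) / 2.
have eta0 : 0 < eta by rewrite divr_gt0// lt_min delta0 subr_gt0.
have eta1 : 2 * eta <= delta by rewrite mulrCA divff ?mulr1 ?pnatr_eq0// ge_min lexx.
have eta2 : 2 * eta <= 1 - delta.
  by rewrite mulrCA divff ?mulr1 ?pnatr_eq0// ge_min lexx orbT.
(* After multiplication by [n ^ eta] the deviation is at most [M * n ^ (1 + delta)]; the first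
   summand of [M] stems from [error], the second from rounding [n ^ delta] to [k]. *)
pose K := `|K1| + `|K2| + `|K3|; pose M := K * (2 * (1 + eta^-1)) + `|D|.
apply/cvgrPdist_le => eps eps0; near=> n.
have n0 : (0 < n)%N by near: n; exact: nbhs_infty_gt.
have xk : x * (k n)%:R + 2 <= C * n%:R by near: n; exact: near_k_small.
have big : M / eps <= n%:R `^ eta by near: n; exact: near_le_powR.
have N1 : 1 <= n%:R :> R by rewrite ler1n.
have N0 : 0 < n%:R :> R by rewrite ltr0n.
have [T0 Tlower] := lower n n0 xk.
have Tupper := upper n n0 T0.
have := approx n n0; rewrite ler_norml => /andP[Glower Gupper].
have [l0 err1 _] := error_ge delta n0.
have err0 : 0 <= error delta n.
  by apply: le_trans err1; rewrite addr_ge0 ?sqr_ge0 ?mulr_ge0 ?addr_ge0.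
have kle : (k n)%:R <= n%:R `^ delta < (k n)%:R + 1.
  by rewrite natr1 truncn_itv// powR_ge0.
have TR0 : 0 < (barvinok_T delta B C n)%:R :> R by rewrite ltr0n.
rewrite ln_div ?posrE ?barvinok_G_gt0//.
set LT := ln _ in Tlower Tupper *; set LG := ln _ in Glower Gupper *.
have main : `|LT - LG - (k n)%:R * n%:R * D| <= K * error delta n.
  have b1 : K1 * error delta n <= `|K1| * error delta n.
    by rewrite ler_wpM2r// ler_norm.
  have b2 : K2 * error delta n <= `|K2| * error delta n.
    by rewrite ler_wpM2r// ler_norm.
  have b3 : K3 * error delta n <= `|K3| * error delta n.
    by rewrite ler_wpM2r// ler_norm.
  have c1 : 0 <= `|K1| * error delta n by rewrite mulr_ge0.
  have c2 : 0 <= `|K2| * error delta n by rewrite mulr_ge0.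
  by rewrite ler_norml /K /D; apply/andP; split; lra.
set P := n%:R `^ (1 + delta).
have PE : P = n%:R * n%:R `^ delta.
  by rewrite /P powRD ?powRr1 ?ler0n// (gt_eqF N0) implybT.
have P0 : 0 < P by rewrite powR_gt0.
have E0 : 0 < n%:R `^ eta :> R by rewrite powR_gt0.
(* The floor in [k] shifts the main term by at most [n |D|], and
   [n * n ^ eta <= n ^ (1 + delta)]. *)
have drift : `|(k n)%:R * n%:R * D - P * D| * n%:R `^ eta <= `|D| * P.
  rewrite -mulrBl normrM mulrAC mulrC ler_wpM2l// PE.
  have -> : `|(k n)%:R * n%:R - n%:R * n%:R `^ delta|
      = n%:R * (n%:R `^ delta - (k n)%:R).
    rewrite ler0_norm; first by ring.
    by rewrite mulrC -mulrBr pmulr_rle0// subr_le0; case/andP: kle.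
  rewrite -mulrA ler_wpM2l//.
  apply: (@le_trans _ _ (1 * n%:R `^ eta)).
    by rewrite ler_wpM2r ?powR_ge0//; case/andP: kle => *; lra.
  by rewrite mul1r ler_powR//; lra.
have main' : `|LT - LG - (k n)%:R * n%:R * D| * n%:R `^ eta
    <= K * (2 * (1 + eta^-1)) * P.
  apply: le_trans (ler_wpM2r (ltW E0) main) _.
  rewrite -!mulrA ler_wpM2l ?addr_ge0//.
  by have := error_powR_le n0 eta0 eta1 eta2; rewrite -/P -!mulrA.
have -> : D - 1 / P * (LT - LG)
    = - ((LT - LG - (k n)%:R * n%:R * D) + ((k n)%:R * n%:R * D - P * D)) / P.
  by field; rewrite gt_eqF.
rewrite normrM normrN normfV (gtr0_norm P0) ler_pdivrMr//.
rewrite -(ler_pM2r E0).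
apply: (@le_trans _ _ (M * P)).
  apply: le_trans (ler_wpM2r (ltW E0) (ler_normD _ _)) _.
  by rewrite mulrDl /M mulrDl lerD.
rewrite mulrAC ler_pM2r// mulrC.
by move: big; rewrite ler_pdivrMr// mulrC.
Unshelve. all: by end_near. Qed.

Lemma entropy_fE (x : R) : entropy_f x = tangent x x 1.
Proof. by rewrite /entropy_f /tangent [x + 1]addrC; ring. Qed.

Lemma ln_onePV : ln (1 + 1 / C) = ln (1 + C) - ln C.
Proof.
rewrite -ln_div ?posrE ?addr_gt0//; congr ln; field.
by rewrite gt_eqF.
Qed.

End Limit.

(** * Optimal parameters in the two regimes and the sign of the excess *)

Theorem theorem2p2 (R : realType) (delta B C : R)
    (hdelta0 : 0 < delta) (hdelta1 : delta < 1) (hB : 0 < B) (hC : 0 < C) :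
  ((fun n : nat =>
      1 / ((n%:R : R) `^ (1 + delta)) *
      ln ((barvinok_T delta B C n)%:R / barvinok_G delta B C n))
     @ \oo --> (if B <= critical_B C then (0 : R) else excess B C))
  /\ (critical_B C < B -> 0 < excess B C).
Proof.
pose sigma := Num.sqrt (1 + 1 / C); pose x := C * critical_B C.
have sigma2 : sigma ^+ 2 = 1 + 1 / C.
  by rewrite sqr_sqrtr// addr_ge0// divr_ge0// ltW.
have sigma1 : 1 < sigma.
  by rewrite -(@expr_gt1 _ 2) ?sqrtr_ge0// sigma2 ltrDl divr_gt0.
have sigma0 : 0 < sigma by exact: lt_trans sigma1.
have C10 : 0 < 1 + C by rewrite addr_gt0.
(* Equivalently [x / (1 + x) = 1 / sigma]: at the critical mean [x] the weight [t] reaches 1. *)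
have xE : x * (sigma - 1) = 1.
  have -> : x * (sigma - 1) = C * (sigma ^+ 2 - 1).
    by rewrite /x /critical_B -/sigma; ring.
  by rewrite sigma2; field; rewrite gt_eqF.
have x0 : 0 < x by rewrite mulr_gt0// addr_gt0.
have s0 : 0 < sigma^-1 by rewrite invr_gt0.
have s2 : sigma^-1 ^+ 2 = C / (1 + C).
  by rewrite exprVn sigma2; field; rewrite !gt_eqF// addr_gt0.
have excessE : excess B C = block_gain C x - block_gain C (B * C).
  rewrite /excess /block_gain !entropy_fE ln_onePV// [critical_B C * C]mulrC -/x.
  rewrite (_ : C * (B - critical_B C) = B * C - x); last by rewrite /x; ring.
  by ring.
split.
  case: leP => [BBc|BcB].
    (* Up to the threshold the optimal mean is [B C] itself, so the gains cancel; [t] solves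
       [s t = B C / (1 + B C)], and [t <= 1] amounts to [B C <= x]. *)
    rewrite -[X in _ --> X](subrr (block_gain C (B * C))).
    have BC0 : 0 < B * C by rewrite mulr_gt0.
    have BC10 : 0 < 1 + B * C by rewrite addr_gt0.
    apply: (@ln_ratio_cvg _ _ _ _ _ _ _ _ sigma^-1 (B * C / (1 + B * C) * sigma)) => //.
    - rewrite mulr_gt0 ?divr_gt0//= mulrAC ler_pdivrMr// mul1r.
      have : B * C * (sigma - 1) <= 1.
        apply: (@le_trans _ _ (x * (sigma - 1))); last by rewrite xE.
        by rewrite ler_pM2r ?subr_gt0// /x mulrC ler_pM2l.
      lra.
    - by rewrite mulrC mulfK ?gt_eqF.
    - by rewrite subrr mul0r.
  rewrite excessE.
  apply: (@ln_ratio_cvg _ _ _ _ _ _ _ _ sigma^-1 1) => //.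
  - by rewrite ltr01 lexx.
  - by rewrite /x mulrC ler_pM2r// ltW.
  - have -> : 1 + x = x * sigma by lra.
    by field; rewrite !gt_eqF.
  - by rewrite ln1 mulr0.
move=> BcB; rewrite excessE.
have BC0 : 0 < B * C by rewrite mulr_gt0.
have lt_xBC : x < B * C by rewrite /x mulrC ltr_pM2r.
move: (B * C) BC0 lt_xBC => y y0 xy.
have x10 : 0 < 1 + x by rewrite addr_gt0.
have y10 : 0 < 1 + y by rewrite addr_gt0.
(* The derivative of [block_gain] vanishes at the critical [x], because
   [1 + 1 / C = ((1 + x) / x)^2]. *)
have slope : ln (1 + C) - ln C = 2 * (ln (1 + x) - ln x).
  rewrite -ln_onePV// -sigma2 lnXn// -(mulr_natl (ln _)) -ln_div ?posrE//.
  congr (_ * ln _); apply/(mulIf (lt0r_neq0 x0)); rewrite divfK ?gt_eqF//; lra.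
(* Half the difference of the gains is [- y ln v1 - ln v2]. The bounds [v - 1] for the logarithms
   add up to 0, and the one for [v2] is strict since [x < y]. *)
pose v1 := x * (1 + y) / ((1 + x) * y); pose v2 := (1 + y) / (1 + x).
have v10 : 0 < v1 by rewrite /v1 divr_gt0// mulr_gt0.
have v20 : 0 < v2 by rewrite /v2 divr_gt0.
have v2_neq1 : ln v2 != 0 by rewrite ln_eq0// gt_eqF// /v2 ltr_pdivlMr// mul1r ltrD2l.
have lt_v2 : ln v2 < v2 - 1.
  by have := expR_gt1Dx v2_neq1; rewrite lnK ?posrE//; lra.
have le_v1 := ler_wpM2l (ltW y0) (ln_le_subr1 v10).
have lnv1 : ln v1 = ln x + ln (1 + y) - (ln (1 + x) + ln y).
  rewrite -lnM ?posrE// -[in RHS]lnM ?posrE// -ln_div ?posrE//; exact: mulr_gt0.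
have lnv2 : ln v2 = ln (1 + y) - ln (1 + x) by rewrite /v2 ln_div ?posrE.
have sum0 : y * (v1 - 1) + (v2 - 1) = 0.
  by rewrite /v1 /v2; field; rewrite !gt_eqF.
rewrite /block_gain /tangent slope; rewrite lnv1 in le_v1; rewrite lnv2 in lt_v2.
lra.
Qed.
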